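(* Let $f,g\ge 0$ be integrable functions on $\mathbb{T}$ with $\log f,\log g\in L_1(\mathbb{T})$, so that the spectral factors $f^+$ and $g^+$ exist. Then $$ \|f^+ - g^+\|_{H_2}^2 \le 2\|f - g\|_{L_1} + 2.5\, \|f\|_{L_\infty} \|\log f - \log g\|_{L_1}. $$
   Context: $\mathbb{T}$ is the unit circle, parametrized by $e^{i\vartheta}$, $\vartheta\in[-\pi,\pi)$. Norms are unnormalized: $\|h\|_{L_1}=\int_{-\pi}^{\pi}|h(e^{i\vartheta})|\,d\vartheta$, $\|h\|_{L_\infty}$ is the essential supremum, and for $F$ in the Hardy space $H_2(\mathbb{D})$, $\|F\|_{H_2}^2=\int_{-\pi}^{\pi}|F(e^{i\vartheta})|^2\,d\vartheta$ (boundary values). For a nonnegative $f\in L_1(\mathbb{T})$ with $\log f\in L_1(\mathbb{T})$, its spectral factor is the outer function $$ f^+(z)=\exp\left(\frac 1{4\pi}\int_0^{2\pi}\frac{e^{i\theta}+z}{e^{i\theta}-z}\log f(e^{i\theta})\,d\theta\right),\quad |z|<1, $$ which is positive at the origin and satisfies $|f^+|^2=f$ a.e. on $\mathbb{T}$. *)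

(* Defs.v *)
From HB Require Import structures.
From mathcomp Require Import all_boot all_order all_algebra.
From mathcomp Require Import all_classical all_reals all_analysis.
From mathcomp Require Import complex ess_sup_inf.
Set Implicit Arguments.
Unset Strict Implicit.
Unset Printing Implicit Defensive.
Import Order.TTheory GRing.Theory Num.Theory.
Import numFieldNormedType.Exports.
Local Open Scope classical_set_scope.
Local Open Scope ring_scope.
Local Open Scope complex_scope.

Section SpectralFactor.
Variable R : realType.

(* parameter domain [-pi, pi] of the circle (endpoint immaterial: null set) *)
Definition Tdom : set R := `[- pi, pi].

Definition expi (t : R) : R[i] := cos t +i* sin t.

Definition cexp (w : R[i]) : R[i] := (expR (complex.Re w))%:C * expi (complex.Im w).

Definition csqnorm (w : R[i]) : R := complex.Re w ^+ 2 + complex.Im w ^+ 2.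

Definition in_disk (z : R[i]) : Prop := csqnorm z < 1.

Definition herglotz_log_integral (f : R[i] -> R) (z : R[i]) : R[i] :=
  (Rintegral lebesgue_measure `[0, 2 * pi]
     (fun t => complex.Re ((expi t + z) / (expi t - z)) * ln (f (expi t))))
  +i*
  (Rintegral lebesgue_measure `[0, 2 * pi]
     (fun t => complex.Im ((expi t + z) / (expi t - z)) * ln (f (expi t)))).

(* The spectral factor f^+ (outer function), for |z| < 1 *)
Definition spectral_factor (f : R[i] -> R) (z : R[i]) : R[i] :=
  cexp ((1 / (4 * pi))%:C * herglotz_log_integral f z).

Definition boundary_value (F : R[i] -> R[i]) (theta : R) : R[i] :=
  (lim (complex.Re (F (r%:C * expi theta)) @[r --> 1^'-]))
  +i* (lim (complex.Im (F (r%:C * expi theta)) @[r --> 1^'-])).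

Definition H2_sqnorm (F : R[i] -> R[i]) : \bar R :=
  (\int[lebesgue_measure]_(t in Tdom) (csqnorm (boundary_value F t))%:E)%E.

Definition L1_norm (h : R[i] -> R) : \bar R :=
  (\int[lebesgue_measure]_(t in Tdom) (`|h (expi t)|)%:E)%E.

Definition Linf_norm (h : R[i] -> R) : \bar R :=
  ess_sup (mrestr (@lebesgue_measure R) (measurable_itv `[- pi, pi]))
          (fun t => (`|h (expi t)|)%:E).

End SpectralFactor.

(* Main.v *)
(* For r < 1 write f_r, g_r for the spectral factors on the circle |z| = r,
   h = log f - log g = h+ - h-, and M for the supremum of f.  Everything is
   proved at a fixed r, uniformly in r; Fatou's lemma then gives the boundary
   inequality, and only needs that the squared modulus of the radial limit is
   at most the lower limit along r -> 1.

   Let A, B be the Herglotz integrals of h+/2 and h-/2, so that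
   f_r / g_r = exp (A - B), and put a = Re A, b = Re B, c = cos (Im (A - B)).
   - Jensen's inequality for the Poisson kernel bounds max (|g_r|^2 - M, 0) by
     the Poisson integral of max (g - M, 0), whose mean is at most that of
     |f - g|.  Pointwise,
       |f_r - g_r|^2 <= 2 max (|g_r|^2 - M, 0) + (M / 2) (a + b) + 2 M (1 - c).
   - For X = exp (- A), Y = exp (- B) one has
       1 - c <= (a + b) / 4 + 2 - |X + Y|^2 / 2,
     and the mean of |X + Y|^2 is at least |X(0) + Y(0)|^2 by the mean value
     property, so the mean of 1 - c is at most 9/4 of the mean of a + b, which
     is half the mean of |h|.  Together: M (1/4 + 9/4) = 2.5 M.
   Both steps rest on (1 - exp (- s))^2 <= s / 2 for s >= 0. *)
Require Import Defs.
From HB Require Import structures.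
From mathcomp Require Import all_boot all_order all_algebra.
From mathcomp Require Import all_classical all_reals all_analysis.
From mathcomp Require Import complex ess_sup_inf.
From mathcomp Require Import measurable_realfun ring lra.
Import Order.TTheory GRing.Theory Num.Theory.
Import numFieldNormedType.Exports.
Local Open Scope classical_set_scope.
Local Open Scope ring_scope.
Local Open Scope complex_scope.
Import Normc.

Ltac complex_ring :=
  apply/eqP; rewrite eq_complex /=; apply/andP; split; apply/eqP; ring.

(** * The complex exponential *)

Section ComplexExponential.
Set Implicit Arguments.
Unset Strict Implicit.
Context {R : realType}.
Implicit Types (w z : R[i]) (s t x y : R).

Lemma normc_expi t : normc (expi t) = 1.
Proof. by rewrite /normc /expi cos2Dsin2 sqrtr1. Qed.

Lemma expiD s t : expi (s + t) = expi s * expi t.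
Proof. by rewrite /expi cosD sinD; complex_ring. Qed.

Lemma expi0 : expi (0 : R) = 1.
Proof. by rewrite /expi cos0 sin0. Qed.

Lemma expiMn t n : expi (t *+ n) = expi t ^+ n.
Proof. by elim: n => [|n ih]; rewrite ?expi0 // mulrS expiD ih exprS. Qed.

Lemma expiKV t : expi t * expi (- t) = 1.
Proof. by rewrite -expiD subrr expi0. Qed.

Lemma cexpD w z : cexp (w + z) = cexp w * cexp z.
Proof.
case: w z => a b [c d]; rewrite /cexp /= expRD expiD rmorphM.
by rewrite !mulrA; congr (_ * _); rewrite -!mulrA; congr (_ * _); rewrite mulrC.
Qed.

Lemma cexp0 : cexp (0 : R[i]) = 1.
Proof. by rewrite /cexp /= expR0 expi0 mulr1. Qed.

Lemma cexpMn w n : cexp (w *+ n) = cexp w ^+ n.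
Proof. by elim: n => [|n ih]; rewrite ?cexp0 // mulrS cexpD ih exprS. Qed.

Lemma normc_cexp w : normc (cexp w) = expR (complex.Re w).
Proof.
rewrite /cexp normcM normc_expi mulr1 /normc /= expr0n addr0 sqrtr_sqr.
by rewrite ger0_norm ?expR_ge0.
Qed.

(** From exp (- x) >= 1 - x follows exp x <= 1 / (1 - x), and (1 + x + 2 x^2) (1 - x) = 1 + x^2 (1 -
    2 x) is at least 1 for x <= 1/2. *)
Lemma expR_le_quadratic x : x <= 1 / 2 -> expR x <= 1 + x + 2 * x ^+ 2.
Proof.
move=> hx; have h1 : 0 < 1 - x by lra.
have h2 : expR x <= (1 - x)^-1.
  by rewrite -[x]opprK expRN opprK lef_pV2 ?posrE ?expR_gt0 // expR_ge1Dx.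
apply: (le_trans h2); rewrite -[leRHS](mulfK (lt0r_neq0 h1)) ler_pdivlMr ?mulVf ?lt0r_neq0 //.
have : (1 + x + 2 * x ^+ 2) * (1 - x) - 1 = x ^+ 2 * (1 - 2 * x) by ring.
move=> e; rewrite -subr_ge0 e mulr_ge0 ?sqr_ge0 //; lra.
Qed.

(** The mean value point is kept: besides |sin y| <= |y|, the factor [cos c] yields the second-order
    estimate in [cexp_sub_linear]. *)
Lemma sin_mvt y : exists2 c, `|c| <= `|y| & sin y = cos c * y.
Proof.
have pos (u : R) : 0 <= u -> exists2 c, `|c| <= `|u| & sin u = cos c * u :> R.
  move=> u0; have [c] := @MVT_segment R sin cos 0 u u0
    (fun x _ => is_derive_sin x) (continuous_subspaceT (@continuous_sin R)).
  rewrite in_itv /= sin0 !subr0 => /andP[c0 cu] e; exists c => //.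
  by rewrite !ger0_norm.
case: (leP 0 y) => [/pos //|y0]; have [|c cy e] := pos (- y); first by lra.
by exists c; [rewrite -(normrN y)|move: e; rewrite sinN mulrN => /oppr_inj].
Qed.

Lemma normr_sin_le y : `|sin y| <= `|y|.
Proof.
have [c _ ->] := sin_mvt y; rewrite normrM ler_piMl // ?normr_ge0 //.
exact: cos_max.
Qed.

Lemma onem_cos_le y : 1 - cos y <= y ^+ 2 / 2.
Proof.
have -> : y = (y / 2) *+ 2 by rewrite mulr2n; field.
rewrite cos_mulr2n cos2sin2; have := normr_sin_le (y / 2).
rewrite -ler_sqr ?nnegrE // !real_normK ?num_real // => h.
rewrite mulr2n; move: h; set a := sin _; nra.
Qed.

(** The real and imaginary parts are each within 3 |w|^2, and 3 sqrt 2 < 6. *)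
Lemma cexp_sub_linear w : normc w <= 1 / 2 ->
  normc (cexp w - (1 + w)) <= 6 * normc w ^+ 2.
Proof.
case: w => x y h; set n := normc _ in h *.
have n0 : 0 <= n by exact: sqrtr_ge0.
have n2 : n ^+ 2 = x ^+ 2 + y ^+ 2 by rewrite sqr_sqrtr ?addr_ge0 ?sqr_ge0.
have xn : `|x| <= n by rewrite -ler_sqr ?nnegrE // real_normK ?num_real // n2; nra.
have yn : `|y| <= n by rewrite -ler_sqr ?nnegrE // real_normK ?num_real // n2; nra.
have ex : expR x <= 1 + x + 2 * x ^+ 2.
  by apply: expR_le_quadratic; move: xn; rewrite ler_norml; lra.
have ex' := expR_ge1Dx x.
have ex2 : expR x <= 2 by move: xn; rewrite ler_norml; nra.
have ex0 := expR_gt0 x.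
have c1 := cos_le1 y; have c2 := onem_cos_le y.
(* With sin y = y cos c, the imaginary part becomes y (exp x cos c - 1), a product of two
   first-order quantities. *)
have [c cy sy] := sin_mvt y.
have cc1 := cos_le1 c; have cc2 := onem_cos_le c.
have re : `|expR x * cos y - (1 + x)| <= 3 * n ^+ 2.
  rewrite n2 ler_norml; apply/andP; split; nra.
have im : `|expR x * sin y - y| <= 3 * n ^+ 2.
  have -> : expR x * sin y - y = y * (expR x * cos c - 1) by rewrite sy; ring.
  rewrite normrM.
  have c3 : c ^+ 2 <= n / 2.
    have := le_trans cy yn; rewrite ler_norml => /andP[? ?]; nra.
  have e1 : `|expR x * cos c - 1| <= 3 * n.
    move: xn; rewrite ler_norml => /andP[? ?].
    rewrite ler_norml; apply/andP; split; nra.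
  by rewrite (le_trans (ler_pM _ _ yn e1)) //; nra.
have -> : cexp (x +i* y) - (1 + (x +i* y)) =
   (expR x * cos y - (1 + x)) +i* (expR x * sin y - y).
  by rewrite /cexp /expi; complex_ring.
rewrite /normc -(@ler_sqr R) ?nnegrE ?sqrtr_ge0 //; last by nra.
rewrite sqr_sqrtr ?addr_ge0 ?sqr_ge0 //.
move: re im; rewrite !ler_norml => /andP[? ?] /andP[? ?]; nra.
Qed.

Lemma normcX z n : normc (z ^+ n) = normc z ^+ n.
Proof. by elim: n => [|n ih]; rewrite ?normc1 // !exprS normcM ih. Qed.

Lemma normc_ge0 z : 0 <= normc z.
Proof. by case: z => a b; exact: sqrtr_ge0. Qed.

Lemma normc_real x : normc x%:C = `|x|.
Proof. by rewrite /normc /= expr0n addr0 sqrtr_sqr. Qed.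

Lemma normc_nat n : normc (n%:R : R[i]) = n%:R.
Proof.
by elim: n => [|n ih]; rewrite ?normc0 // -(@normr_nat R) -normc_real rmorph_nat.
Qed.

(** Induction on z^(n+1) - w^(n+1) = z (z^n - w^n) + (z - w) w^n. At n = 0 the truncated exponent
    [n.-1] is harmless, since the factor n vanishes. *)
Lemma normc_subX_le z w K n : normc z <= K -> normc w <= K ->
  normc (z ^+ n - w ^+ n) <= n%:R * K ^+ n.-1 * normc (z - w).
Proof.
move=> zK wK; have K0 := le_trans (normc_ge0 z) zK.
elim: n => [|n ih]; first by rewrite subrr normc0 !mul0r.
have -> : z ^+ n.+1 - w ^+ n.+1 = z * (z ^+ n - w ^+ n) + (z - w) * w ^+ n.
  by rewrite !exprS; ring.
apply: (le_trans (le_normcD _ _)); rewrite !normcM normcX.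
have a : normc z * normc (z ^+ n - w ^+ n) <= K * (n%:R * K ^+ n.-1 * normc (z - w)).
  by rewrite ler_pM ?normc_ge0.
have b : normc (z - w) * normc w ^+ n <= K ^+ n * normc (z - w).
  by rewrite mulrC ler_wpM2r ?normc_ge0 // lerXn2r ?nnegrE ?normc_ge0.
apply: (le_trans (lerD a b)); rewrite /= le_eqVlt; apply/orP; left; apply/eqP.
case: n {ih a b} => [|n] /=; first by rewrite expr0; ring.
by rewrite [in RHS]mulrSr exprS /=; ring.
Qed.

(* The classical limit (1 + w/n)^n -> exp w, with an explicit rate that is
   uniform on bounded sets and tolerates an error of order 1/n in w. *)
Lemma cexp_approx_expn w z L n : 0 <= L -> normc w <= L -> normc z <= L ->
  (0 < n)%N -> 2 * L <= n%:R ->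
  normc (cexp w - (1 + z / n%:R) ^+ n) <= expR L * (6 * L ^+ 2 / n%:R + normc (w - z)).
Proof.
move=> L0 wL zL n0 nL; have nR : 0 < n%:R :> R by rewrite ltr0n.
have nn : (n%:R : R[i]) != 0 by rewrite pnatr_eq0 -lt0n.
have e1 : cexp w = cexp (w / n%:R) ^+ n.
  by rewrite -cexpMn -[(_ / _) *+ _]mulr_natr divfK.
have nV (v : R[i]) : normc (v / n%:R) = normc v / n%:R.
  by rewrite normcM normcV; rewrite normc_nat.
have h1 : normc (cexp (w / n%:R)) <= expR (L / n%:R).
  rewrite normc_cexp ler_expR; apply: (@le_trans _ _ (normc (w / n%:R))); last first.
    by rewrite nV ler_pM2r // invr_gt0.
  case: (w / _) => a b /=; apply: (le_trans (ler_norm a)).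
  by rewrite -sqrtr_sqr ler_sqrt ?addr_ge0 ?sqr_ge0 // lerDl sqr_ge0.
have h2 : normc (1 + z / n%:R) <= expR (L / n%:R).
  apply: (le_trans (le_normcD _ _)); rewrite normc1 nV.
  by apply: le_trans (expR_ge1Dx _); rewrite lerD2l ler_pM2r // invr_gt0.
rewrite e1; apply: (le_trans (normc_subX_le n h1 h2)).
(* The error of one factor is the linearization error at w / n, allowed since 2 L <= n gives |w / n|
   <= 1/2, plus (w - z) / n. *)
have h3 : normc (cexp (w / n%:R) - (1 + z / n%:R)) <=
    (6 * L ^+ 2 / n%:R + normc (w - z)) / n%:R.
  have -> : cexp (w / n%:R) - (1 + z / n%:R) =
    (cexp (w / n%:R) - (1 + w / n%:R)) + (w - z) / n%:R by ring.
  apply: (le_trans (le_normcD _ _)); rewrite nV mulrDl lerD2r.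
  apply: le_trans (cexp_sub_linear _) _; rewrite nV.
    by rewrite ler_pdivrMr // (le_trans wL) //; lra.
  have -> : 6 * (normc w / n%:R) ^+ 2 = 6 * normc w ^+ 2 / n%:R / n%:R.
    by field; rewrite lt0r_neq0.
  rewrite !ler_wpM2r ?invr_ge0 ?ler0n // ler_wpM2l // lerXn2r ?nnegrE ?normc_ge0 //.
apply: (@le_trans _ _ (n%:R * expR (L / n%:R) ^+ n.-1 *
   ((6 * L ^+ 2 / n%:R + normc (w - z)) / n%:R))).
  by rewrite ler_wpM2l // mulr_ge0 // exprn_ge0 ?expR_ge0.
rewrite (_ : _ * _ = expR (L / n%:R) ^+ n.-1 * (6 * L ^+ 2 / n%:R + normc (w - z))); last first.
  by field; rewrite lt0r_neq0.
rewrite ler_wpM2r //.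
  by rewrite addr_ge0 ?normc_ge0 // divr_ge0 ?mulr_ge0 ?sqr_ge0 // ltW.
rewrite -expRM_natl ler_expR mulrA mulrAC ler_piMl //.
by rewrite ler_pdivrMr // mul1r ler_nat leq_pred.
Qed.

End ComplexExponential.

(** * Functions of the disk algebra on a circle *)

Section DiskApproximation.
Set Implicit Arguments.
Unset Strict Implicit.
Context {R : realType}.
Implicit Types (p q : {poly R[i]}) (r t : R) (c : R[i]) (Phi : R -> R[i]).

(* The boundary values on the circle |z| = r of a function of the disk algebra
   with value c at the center. *)
Definition disk_approx r Phi c := forall e : R, 0 < e -> exists p,
  (forall t, normc (Phi t - p.[r%:C * expi t]) <= e) /\ normc (c - p.[0]) <= e.

Lemma normr_Re_le (z : R[i]) : `|complex.Re z| <= normc z.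
Proof.
by case: z => a b /=; rewrite -sqrtr_sqr ler_sqrt ?addr_ge0 ?sqr_ge0 // lerDl sqr_ge0.
Qed.

Lemma normr_Im_le (z : R[i]) : `|complex.Im z| <= normc z.
Proof.
by case: z => a b /=; rewrite -sqrtr_sqr ler_sqrt ?addr_ge0 ?sqr_ge0 // lerDr sqr_ge0.
Qed.

Lemma complexReM (z w : R[i]) :
  complex.Re (z * w) = complex.Re z * complex.Re w - complex.Im z * complex.Im w.
Proof. by case: z w => a b [c d]. Qed.

Lemma complexImM (z w : R[i]) :
  complex.Im (z * w) = complex.Re z * complex.Im w + complex.Im z * complex.Re w.
Proof. by case: z w => a b [c d]. Qed.

Lemma complexReD (z w : R[i]) : complex.Re (z + w) = complex.Re z + complex.Re w.
Proof. by case: z w => a b [c d]. Qed.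

Lemma complexImD (z w : R[i]) : complex.Im (z + w) = complex.Im z + complex.Im w.
Proof. by case: z w => a b [c d]. Qed.

Lemma complexReB (z w : R[i]) : complex.Re (z - w) = complex.Re z - complex.Re w.
Proof. by case: z w => a b [c d]. Qed.

Lemma complexImB (z w : R[i]) : complex.Im (z - w) = complex.Im z - complex.Im w.
Proof. by case: z w => a b [c d]. Qed.

Lemma horner_circle_continuous r p :
  continuous (fun t => complex.Re p.[r%:C * expi t]) /\
  continuous (fun t => complex.Im p.[r%:C * expi t]).
Proof.
elim/poly_ind: p => [|p a [ihr ihi]].
  split=> t; rewrite (_ : (fun _ => _) = fun=> 0); first exact: cvg_cst.
  - by apply/funext => s; rewrite horner0.
  - exact: cvg_cst.
  - by apply/funext => s; rewrite horner0.
have cr : continuous (fun t : R => r * cos t).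
  by move=> t; apply: cvgM; [exact: cvg_cst|exact: continuous_cos].
have ci : continuous (fun t : R => r * sin t).
  by move=> t; apply: cvgM; [exact: cvg_cst|exact: continuous_sin].
split=> t.
  rewrite (_ : (fun _ => _) = fun t => complex.Re p.[r%:C * expi t] * (r * cos t)
     - complex.Im p.[r%:C * expi t] * (r * sin t) + complex.Re a); last first.
    by apply/funext => s; rewrite hornerMXaddC complexReD !complexReM complexImM /= !mul0r addr0 subr0.
  apply: cvgD; last exact: cvg_cst.
  by apply: cvgB; apply: cvgM; [exact: ihr|exact: cr|exact: ihi|exact: ci].
rewrite (_ : (fun _ => _) = fun t => complex.Re p.[r%:C * expi t] * (r * sin t)
   + complex.Im p.[r%:C * expi t] * (r * cos t) + complex.Im a); last first.
  by apply/funext => s; rewrite hornerMXaddC complexImD !complexImM complexReM /= !mul0r addr0 subr0.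
apply: cvgD; last exact: cvg_cst.
by apply: cvgD; apply: cvgM; [exact: ihr|exact: ci|exact: ihi|exact: cr].
Qed.

Lemma uniform_limit_continuous (u : R -> R) :
  (forall e : R, 0 < e -> exists2 v : R -> R, continuous v & forall t, `|u t - v t| <= e) ->
  continuous u.
Proof.
move=> h t; apply/cvgrPdist_le => e e0.
have [|v cv uv] := h (e / 3); first by rewrite divr_gt0.
have /cvgrPdist_le /(_ (e / 3)) := cv t; rewrite divr_gt0 // => /(_ isT).
apply: filterS => s vs.
have -> : u t - u s = (u t - v t) + (v t - v s) - (u s - v s) by ring.
apply: (le_trans (ler_normB _ _)); rewrite (le_trans (lerD (ler_normD _ _) (lexx _))) //.
by have := uv t; have := uv s; lra.
Qed.

Lemma disk_approx_continuous r Phi c : disk_approx r Phi c ->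
  continuous (fun t => complex.Re (Phi t)) /\ continuous (fun t => complex.Im (Phi t)).
Proof.
move=> h; split; apply: uniform_limit_continuous => e /h[p [hp _]].
  exists (fun t => complex.Re p.[r%:C * expi t]); first by case: (horner_circle_continuous r p).
  by move=> t /=; rewrite -complexReB (le_trans (normr_Re_le _)).
exists (fun t => complex.Im p.[r%:C * expi t]); first by case: (horner_circle_continuous r p).
by move=> t /=; rewrite -complexImB (le_trans (normr_Im_le _)).
Qed.

(** A polynomial within distance 1 is bounded by induction on its Horner form. The bound is common
    to circle and center, so that [disk_approx_cexp] treats both by one estimate. *)
Lemma disk_approx_bounded r Phi c : disk_approx r Phi c ->
  exists2 B : R, 0 <= B & normc c <= B /\ forall t, normc (Phi t) <= B.
Proof.
move=> h; have [p [hp hc]] := h _ ltr01.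
have [b b0 [bc bp]] : exists2 b : R, 0 <= b & normc p.[0] <= b /\
    forall t, normc p.[r%:C * expi t] <= b.
  elim/poly_ind: p {hp hc} => [|p a [b b0 [bc ihb]]].
    by exists 0 => //; split=> [|t]; rewrite horner0 normc0.
  exists (b * `|r| + normc a); first by rewrite addr_ge0 ?mulr_ge0 ?normc_ge0.
  split=> [|t]; rewrite hornerMXaddC; apply: (le_trans (le_normcD _ _)).
    by rewrite lerD2r mulr0 normc0 mulr_ge0.
  by rewrite lerD2r !normcM normc_real normc_expi mulr1 ler_wpM2r.
exists (1 + b); first by rewrite addr_ge0.
split=> [|t].
  rewrite -[c](subrK p.[0]); apply: (le_trans (le_normcD _ _)); exact: lerD.
by rewrite -[Phi t](subrK p.[r%:C * expi t]); apply: (le_trans (le_normcD _ _)); exact: lerD.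
Qed.

Lemma disk_approx_poly r p : disk_approx r (fun t => p.[r%:C * expi t]) p.[0].
Proof. by move=> e e0; exists p; split=> [t|]; rewrite subrr normc0 ltW. Qed.

Lemma disk_approxD r Phi Psi c d : disk_approx r Phi c -> disk_approx r Psi d ->
  disk_approx r (fun t => Phi t + Psi t) (c + d).
Proof.
move=> hc hd e e0; have e2 : 0 < e / 2 by rewrite divr_gt0.
have [p [pP pc]] := hc _ e2; have [q [qP qd]] := hd _ e2.
exists (p + q); split=> [t|]; rewrite hornerD opprD addrACA;
  by rewrite (le_trans (le_normcD _ _)) // [e]splitr lerD.
Qed.

Lemma disk_approxZ r Phi c (a : R[i]) : disk_approx r Phi c ->
  disk_approx r (fun t => a * Phi t) (a * c).
Proof.
move=> hc e e0; have a0 := normc_ge0 a.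
have [|p [pP pc]] := hc (e / (1 + normc a)); first by rewrite divr_gt0 // ltr_pwDl.
have le_e x : x <= e / (1 + normc a) -> normc a * x <= e.
  rewrite ler_pdivlMr ?ltr_pwDl // => h; have := normc_ge0 a; nra.
by exists (a%:P * p); split=> [t|]; rewrite hornerCM -mulrBr normcM le_e.
Qed.

(** The polynomials (1 + p / n)^n approximate exp (Phi). The rate depends only on a bound for Phi,
    so one n serves the whole circle and the center. *)
Lemma disk_approx_cexp r Phi c : disk_approx r Phi c ->
  disk_approx r (fun t => cexp (Phi t)) (cexp c).
Proof.
move=> h e e0; have [B B0 [cB PB]] := disk_approx_bounded h.
(* [L] also bounds the approximants, which stay within 1 of Phi by the choice of [d]. The threshold
   on [n] and the second entry of [d] make each of the two error terms at most e / 2. *)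
pose L := B + 1; have L0 : 0 <= L by rewrite addr_ge0.
have [n n1 [n2 n3]] : exists2 n, (0 < n)%N & 2 * L <= n%:R /\ 12 * L ^+ 2 * expR L / e <= n%:R.
  have : 0 <= 12 * L ^+ 2 * expR L / e.
    by rewrite divr_ge0 ?(ltW e0) // mulr_ge0 ?expR_ge0 // mulr_ge0 ?sqr_ge0.
  set b := _ / e => b0; exists (Num.truncn (2 * L + b)).+1 => //.
  have := truncnS_gt (2 * L + b); set k := _%:R => kb.
  by split; lra.
pose d := Num.min 1 (e / (2 * expR L)).
have d0 : 0 < d by rewrite lt_min ltr01 divr_gt0 // mulr_gt0 // expR_gt0.
have [p [pP pc]] := h _ d0.
have nR : 0 < n%:R :> R by rewrite ltr0n.
have key (w z : R[i]) : normc w <= B -> normc (w - z) <= d ->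
    normc (cexp w - (1 + z / n%:R) ^+ n) <= e.
  move=> wB wz; have wL : normc w <= L by rewrite (le_trans wB) // lerDl.
  have zL : normc z <= L.
    rewrite -[z](subrK w); apply: (le_trans (le_normcD _ _)).
    rewrite addrC lerD // -normcN opprB (le_trans wz) // ge_min lexx //.
  apply: (le_trans (cexp_approx_expn L0 wL zL n1 n2)).
  have h1 : expR L * (6 * L ^+ 2 / n%:R) <= e / 2.
    rewrite !mulrA ler_pdivrMr //.
    by move: n3; rewrite ler_pdivrMr //; nra.
  have h2 : expR L * normc (w - z) <= e / 2.
    have : normc (w - z) <= e / (2 * expR L) by rewrite (le_trans wz) // ge_min lexx orbT.
    rewrite ler_pdivlMr ?mulr_gt0 ?expR_gt0 //; lra.
  by rewrite mulrDr [e]splitr lerD.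
exists ((1 + (n%:R^-1)%:P * p) ^+ n); split=> [t|]; rewrite horner_exp hornerD hornerC hornerCM mulrC;
  exact: key.
Qed.

End DiskApproximation.

(** * The mean value property on a circle *)

Section MeanValue.
Set Implicit Arguments.
Unset Strict Implicit.
Context {R : realType}.
Notation mu := (@lebesgue_measure R).
Notation D := (@Tdom R).
Implicit Types (p q : {poly R[i]}) (r t : R) (c : R[i]) (Phi : R -> R[i]).

Lemma measurable_Tdom : @measurable _ (measurableTypeR R) D.
Proof. exact: measurable_itv. Qed.

Lemma fine_measure_Tdom : fine (mu D) = 2 * pi.
Proof.
have p0 := @pi_gt0 R.
rewrite /Tdom lebesgue_measure_itv /= lte_fin ifT /=; [ring|lra].
Qed.

Lemma continuous_integrable_Tdom (u : R -> R) : continuous u -> mu.-integrable D (EFin \o u).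
Proof.
move=> cu; apply: continuous_compact_integrable; first exact: segment_compact.
exact: continuous_subspaceT.
Qed.

Lemma Tdom_integralD (u v : R -> R) :
  mu.-integrable D (EFin \o u) -> mu.-integrable D (EFin \o v) ->
  (\int[mu]_(t in D) (u t + v t) = \int[mu]_(t in D) u t + \int[mu]_(t in D) v t)%R.
Proof. exact: RintegralD measurable_Tdom. Qed.

Lemma Tdom_integralB (u v : R -> R) :
  mu.-integrable D (EFin \o u) -> mu.-integrable D (EFin \o v) ->
  (\int[mu]_(t in D) (u t - v t) = \int[mu]_(t in D) u t - \int[mu]_(t in D) v t)%R.
Proof. exact: RintegralB measurable_Tdom. Qed.

Lemma Tdom_integralZ (k : R) (u : R -> R) : mu.-integrable D (EFin \o u) ->
  (\int[mu]_(t in D) (k * u t) = k * \int[mu]_(t in D) u t)%R.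
Proof. exact: RintegralZl measurable_Tdom. Qed.

Lemma Tdom_integral_cst (k : R) : (\int[mu]_(t in D) k = 2 * pi * k)%R.
Proof.
by rewrite (Rintegral_cst mu measurable_Tdom) fine_measure_Tdom mulrC.
Qed.

Lemma Tdom_integrableD (u v : R -> R) :
  mu.-integrable D (EFin \o u) -> mu.-integrable D (EFin \o v) ->
  mu.-integrable D (EFin \o (fun t => u t + v t)).
Proof. exact: (integrableD measurable_Tdom). Qed.

Lemma Tdom_integrableB (u v : R -> R) :
  mu.-integrable D (EFin \o u) -> mu.-integrable D (EFin \o v) ->
  mu.-integrable D (EFin \o (fun t => u t - v t)).
Proof. exact: (integrableB measurable_Tdom). Qed.

Lemma Tdom_integrableZ (k : R) (u : R -> R) : mu.-integrable D (EFin \o u) ->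
  mu.-integrable D (EFin \o (fun t => k * u t)).
Proof. exact: (integrableZl measurable_Tdom). Qed.

Lemma Tdom_integrable_norm (u : R -> R) : mu.-integrable D (EFin \o u) ->
  mu.-integrable D (EFin \o (fun t => `|u t|)).
Proof. exact: integrable_norm. Qed.

Lemma Tdom_integrable_cst (k : R) : mu.-integrable D (EFin \o (fun=> k)).
Proof. by apply: continuous_integrable_Tdom => t; exact: cvg_cst. Qed.

(** The explicit primitive [F] takes the same value at both endpoints, because sin (n pi) = 0 and
    cos is even. *)
Lemma integral_Re_expiX (a : R[i]) n : (0 < n)%N ->
  (\int[mu]_(t in D) complex.Re (expi t ^+ n * a) = 0)%R.
Proof.
move=> n0; have nR : (n%:R : R) != 0 by rewrite pnatr_eq0 -lt0n.
case: a => x y.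
pose F t : R := n%:R^-1 * (x * sin (n%:R * t) + y * cos (n%:R * t)).
pose f t : R := x * cos (n%:R * t) - y * sin (n%:R * t).
have fE t : complex.Re (expi t ^+ n * (x +i* y)) = f t.
  by rewrite -expiMn complexReM /= /f [n%:R * t]mulr_natl; ring.
have dF t : is_derive t 1 F (f t).
  apply: is_derive_eq; rewrite /f /GRing.scale /=; field.
  by [].
have cF : continuous F.
  by move=> t; apply/differentiable_continuous/derivable1_diffP.
have cf : continuous f.
  have cn : continuous (fun t : R => n%:R * t) by move=> t; apply: cvgM; [exact: cvg_cst|exact: cvg_id].
  move=> t; apply: cvgB; apply: cvgM; try exact: cvg_cst.
    by apply: (continuous_comp (cn t)); exact: continuous_cos.
  by apply: (continuous_comp (cn t)); exact: continuous_sin.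
rewrite /Rintegral; under eq_integral do rewrite fE.
have p0 := @pi_gt0 R.
rewrite (@continuous_FTC2 _ f F).
- have -> : F pi = F (- pi).
    rewrite /F mulrN sinN cosN mulr_natl.
    have -> : sin (pi *+ n) = 0 :> R.
      elim: (n) => [|k ih]; first by rewrite mulr0n sin0.
      by rewrite mulrS addrC sinDpi ih oppr0.
    by rewrite oppr0.
  by rewrite -EFinB subrr.
- by rewrite gtrN.
- exact: continuous_subspaceT.
- split; first by move=> t _; case: (dF t).
  + by apply: cvg_at_right_filter; exact: cF.
  + by apply: cvg_at_left_filter; exact: cF.
- by move=> t _; rewrite derive1E; apply: (@derive_val _ _ _ _ _ _ _ (dF t)).
Qed.

Lemma integral_Re_horner r p :
  (\int[mu]_(t in D) complex.Re p.[r%:C * expi t] = 2 * pi * complex.Re p.[0])%R.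
Proof.
have cont q n : continuous (fun t => complex.Re (expi t ^+ n * q.[r%:C * expi t])).
  have -> : (fun t => complex.Re (expi t ^+ n * q.[r%:C * expi t])) =
    (fun t => complex.Re ('X^n).[1%:C * expi t] * complex.Re q.[r%:C * expi t]
      - complex.Im ('X^n).[1%:C * expi t] * complex.Im q.[r%:C * expi t]).
    by apply/funext => t; rewrite complexReM hornerXn mul1r.
  have [a1 b1] := horner_circle_continuous (1 : R) 'X^n.
  have [a2 b2] := horner_circle_continuous r q.
  by move=> t; apply: cvgB; apply: cvgM; [exact: a1|exact: a2|exact: b1|exact: b2].
(* The claim carries an extra factor exp (i n t): each Horner step multiplies by r exp (i t), which
   raises n by one, so the induction must range over all n > 0. *)
have shifted q n : (0 < n)%N ->
    (\int[mu]_(t in D) complex.Re (expi t ^+ n * q.[r%:C * expi t]) = 0)%R.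
  elim/poly_ind: q n => [|q a ih] n n0.
    under eq_Rintegral do rewrite horner0.
    by rewrite integral_Re_expiX.
  have split_t t : complex.Re (expi t ^+ n * (q * 'X + a%:P).[r%:C * expi t]) =
      r * complex.Re (expi t ^+ n.+1 * q.[r%:C * expi t]) + complex.Re (expi t ^+ n * a).
    rewrite hornerMXaddC exprS mulrDr complexReD; congr (_ + _).
    have -> : expi t ^+ n * (q.[r%:C * expi t] * (r%:C * expi t)) =
      r%:C * (expi t * expi t ^+ n * q.[r%:C * expi t]) by ring.
    by rewrite [LHS]complexReM /= mul0r subr0.
  under eq_Rintegral => t _ do rewrite split_t.
  have i1 : mu.-integrable D (EFin \o (fun t => complex.Re (expi t ^+ n.+1 * q.[r%:C * expi t]))).
    exact/continuous_integrable_Tdom/cont.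
  have i2 : mu.-integrable D (EFin \o (fun t => complex.Re (expi t ^+ n * a))).
    apply: continuous_integrable_Tdom => t; have := cont a%:P n t.
    by under eq_fun do rewrite hornerC.
  rewrite (Tdom_integralD (Tdom_integrableZ r i1) i2) (Tdom_integralZ r i1).
  by rewrite ih // integral_Re_expiX // mulr0 addr0.
elim/poly_ind: p => [|p a _].
  under eq_Rintegral do rewrite horner0.
  by rewrite Tdom_integral_cst horner0.
have split_t t : complex.Re (p * 'X + a%:P).[r%:C * expi t] =
    r * complex.Re (expi t ^+ 1 * p.[r%:C * expi t]) + complex.Re a.
  rewrite hornerMXaddC complexReD; congr (_ + _).
  have -> : p.[r%:C * expi t] * (r%:C * expi t) =
    r%:C * (expi t ^+ 1 * p.[r%:C * expi t]) by ring.
  by rewrite [LHS]complexReM /= mul0r subr0.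
under eq_Rintegral => t _ do rewrite split_t.
have i1 : mu.-integrable D (EFin \o (fun t => complex.Re (expi t ^+ 1 * p.[r%:C * expi t]))).
  exact/continuous_integrable_Tdom/cont.
rewrite (Tdom_integralD (Tdom_integrableZ r i1) (Tdom_integrable_cst _)).
rewrite (Tdom_integralZ r i1) shifted // mulr0 add0r Tdom_integral_cst.
by rewrite hornerMXaddC mulr0 add0r.
Qed.

(** Polynomials satisfy the mean value property exactly, and it survives uniform limits. *)
Lemma disk_approx_integral r Phi c : disk_approx r Phi c ->
  (\int[mu]_(t in D) complex.Re (Phi t) = 2 * pi * complex.Re c)%R.
Proof.
move=> h; have p0 := @pi_gt0 R.
have cPhi := continuous_integrable_Tdom (disk_approx_continuous h).1.
apply/eqP; rewrite -subr_eq0 -normr_eq0; apply/eqP/le_anti/andP; split => //.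
apply/ler_addgt0Pr => e e0; rewrite add0r.
(* Over an interval of length 2 pi, this accuracy costs e / 2 on the circle and e / 2 at the
   center. *)
have [|p [pP pc]] := h (e / (4 * pi)); first by rewrite divr_gt0 // mulr_gt0.
have half : 2 * pi * (e / (4 * pi)) = e / 2.
  by move: (pi) p0 => x x0; field; rewrite lt0r_neq0.
have cp := continuous_integrable_Tdom (horner_circle_continuous r p).1.
set I := Rintegral _ _ _.
have -> : I - 2 * pi * complex.Re c =
    (\int[mu]_(t in D) (complex.Re (Phi t) - complex.Re p.[r%:C * expi t]))%R
    - 2 * pi * (complex.Re c - complex.Re p.[0]).
  by rewrite (Tdom_integralB cPhi cp) integral_Re_horner -/I; ring.
apply: (le_trans (ler_normB _ _)).
have h1 : `|(\int[mu]_(t in D) (complex.Re (Phi t) - complex.Re p.[r%:C * expi t]))%R| <= e / 2.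
  have ci := Tdom_integrableB cPhi cp.
  apply: (le_trans (le_normr_Rintegral measurable_Tdom ci)).
  apply: (@le_trans _ _ (\int[mu]_(t in D) (e / (4 * pi)))%R).
    apply: (le_Rintegral measurable_Tdom (Tdom_integrable_norm ci) (Tdom_integrable_cst _)).
    by move=> t _; rewrite -complexReB (le_trans (normr_Re_le _)).
  by rewrite Tdom_integral_cst half.
have h2 : `|2 * pi * (complex.Re c - complex.Re p.[0])| <= e / 2.
  have hc : `|complex.Re c - complex.Re p.[0]| <= e / (4 * pi).
    by rewrite -complexReB (le_trans (normr_Re_le _)).
  rewrite normrM ger0_norm ?mulr_ge0 ?(ltW p0) //.
  apply: (@le_trans _ _ (2 * pi * (e / (4 * pi)))); first by rewrite ler_wpM2l // mulr_ge0 ?ltW.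
  by rewrite half.
by rewrite [e]splitr lerD.
Qed.

End MeanValue.

(** * The Herglotz kernel and integral *)

Section HerglotzKernel.
Set Implicit Arguments.
Unset Strict Implicit.
Context {R : realType}.
Implicit Types (r s t : R).

(** The Herglotz kernel (1 + z) / (1 - z) at z = r exp (i s); its real part is the Poisson
    kernel. *)
Definition circle_kernel r s : R[i] :=
  (1 + r%:C * expi s) / (1 - r%:C * expi s).

Lemma normc_onem_ge r s : 0 <= r < 1 -> 1 - r <= normc (1 - r%:C * expi s).
Proof.
move=> /andP[r0 r1]; have : normc (1 : R[i]) <= normc (1 - r%:C * expi s) + r.
  rewrite -{1}[1](subrK (r%:C * expi s)); apply: (le_trans (le_normcD _ _)).
  by rewrite lerD2l normcM normc_real normc_expi mulr1 ger0_norm.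
by rewrite normc1; lra.
Qed.

Lemma onem_neq0 r s : 0 <= r < 1 -> 1 - r%:C * expi s != 0.
Proof.
move=> h; apply/eqP => e; have := normc_onem_ge s h; rewrite e normc0.
by case/andP: h => ? ?; lra.
Qed.

(** Cancelling exp (i s) leaves a function of t - s alone, so the Herglotz integral is a
    convolution. *)
Lemma herglotz_kernelE r s t : 0 <= r < 1 ->
  (expi s + r%:C * expi t) / (expi s - r%:C * expi t) = circle_kernel r (t - s).
Proof.
move=> h; have ns := expiKV s; have n0 : expi s != 0.
  by apply/eqP => e; move: ns; rewrite e mul0r => /esym /eqP; rewrite oner_eq0.
have -> : r%:C * expi t = expi s * (r%:C * expi (t - s)).
  have -> : expi t = expi s * expi (t - s) by rewrite -expiD addrC subrK.
  by rewrite mulrCA.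
rewrite /circle_kernel; set b := _ * expi (t - s).
have -> : expi s + expi s * b = expi s * (1 + b) by ring.
have -> : expi s - expi s * b = expi s * (1 - b) by ring.
by rewrite -mulf_div divff // mul1r.
Qed.

(** Since (1 + u) / (1 - u) = 2 / (1 - u) - 1, truncating the geometric series leaves the remainder
    2 u^N / (1 - u), and |1 - u| >= 1 - r. *)
Lemma circle_kernel_geometric r s N : 0 <= r < 1 ->
  normc (circle_kernel r s - (2 * (\sum_(n < N) (r%:C * expi s) ^+ n) - 1))
    <= 2 * r ^+ N / (1 - r).
Proof.
move=> h; have u1 := onem_neq0 s h; have ge1 := normc_onem_ge s h.
case/andP: h => r0 r1; set u := r%:C * expi s in u1 ge1 *.
have nu : normc u = r by rewrite normcM normc_real normc_expi mulr1 ger0_norm.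
have -> : circle_kernel r s - (2 * (\sum_(n < N) u ^+ n) - 1) = 2 * u ^+ N / (1 - u).
  rewrite /circle_kernel -/u; have := subrX1 u N; set S := \sum_(n < N) _ => e.
  have -> : u ^+ N = 1 - (1 - u) * S by rewrite -[u ^+ N](subrK 1) e; ring.
  by field.
rewrite !normcM normcV normc_nat normcX nu ler_wpM2l ?mulr_ge0 ?exprn_ge0 //.
by rewrite lef_pV2 // posrE; lra.
Qed.

Lemma exprn_small r (e : R) : 0 <= r < 1 -> 0 < e -> exists2 N, (0 < N)%N & r ^+ N <= e.
Proof.
move=> /andP[r0 r1] e0.
have /cvgrPdist_le /(_ _ e0) [N _ hN] : (r ^+ n @[n --> \oo] --> (0 : R)).
  by apply: cvg_expr; rewrite ger0_norm.
exists N.+1 => //; have := hN N.+1 (leqnSn N).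
by rewrite /= sub0r normrN ger0_norm // exprn_ge0.
Qed.

(** The rotation by s is absorbed into the coefficients exp (- i n s) of the truncated series. *)
Lemma circle_kernel_approx r s : 0 <= r < 1 ->
  disk_approx r (fun t => circle_kernel r (t - s)) 1.
Proof.
move=> h e e0; have /andP[r0 r1] := h.
have [|N N0 hN] := @exprn_small r (e * (1 - r) / 2) h.
  by rewrite divr_gt0 // mulr_gt0 // subr_gt0.
have small : 2 * r ^+ N / (1 - r) <= e by rewrite ler_pdivrMr ?subr_gt0 //; lra.
exists (2%:P * (\sum_(n < N) (expi (- s) ^+ n)%:P * 'X^n) - 1).
have pE z : (2%:P * (\sum_(n < N) (expi (- s) ^+ n)%:P * 'X^n) - 1).[z] =
    2 * (\sum_(n < N) (expi (- s) * z) ^+ n) - 1.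
  rewrite hornerD hornerN hornerC hornerCM horner_sum; congr (_ * _ - _).
  by apply: eq_bigr => n _; rewrite hornerCM hornerXn exprMn.
split=> [t|]; rewrite pE.
  have -> : expi (- s) * (r%:C * expi t) = r%:C * expi (t - s).
    by rewrite mulrCA -expiD addrC.
  exact: le_trans (circle_kernel_geometric _ _ h) small.
(* [N] is positive, so the truncated series keeps its constant term and takes the value 2 - 1 = 1 at
   the origin. *)
case: N N0 {hN small pE} => // N _; rewrite big_ord_recl expr0 big1 => [|i _].
  by rewrite addr0 (_ : 1 - (2 * 1 - 1) = 0) ?normc0 ?ltW //; ring.
by rewrite mulr0 expr0n.
Qed.

(** The closed form of the Poisson kernel, from which evenness and positivity are read off. *)
Lemma circle_kernel_ReE r s : complex.Re (circle_kernel r s) =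
  (1 - r ^+ 2) / ((1 - r * cos s) ^+ 2 + (r * sin s) ^+ 2).
Proof.
rewrite /circle_kernel complexReM /= !mul0r !subr0 !addr0 add0r.
rewrite add0r sqrrN (_ : 1 - r ^+ 2 = 1 - r ^+ 2 * (cos s ^+ 2 + sin s ^+ 2)).
  by ring.
by rewrite cos2Dsin2 mulr1.
Qed.

Lemma circle_kernel_Re_even r s :
  complex.Re (circle_kernel r (- s)) = complex.Re (circle_kernel r s).
Proof. by rewrite !circle_kernel_ReE cosN sinN mulrN sqrrN. Qed.

Lemma circle_kernel_Re_ge0 r s : 0 <= r < 1 -> 0 <= complex.Re (circle_kernel r s).
Proof.
case/andP=> r0 r1; rewrite circle_kernel_ReE divr_ge0 //.
  by rewrite subr_ge0 expr_le1 // ltW.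
by rewrite addr_ge0 ?sqr_ge0.
Qed.

End HerglotzKernel.

(** * Herglotz integrals of integrable functions *)

Section HerglotzIntegral.
Set Implicit Arguments.
Unset Strict Implicit.
Context {R : realType}.
Notation mu := (@lebesgue_measure R).
Notation D := (@Tdom R).
Implicit Types (r s t : R) (phi psi : R -> R) (F G : R -> R[i]).

Definition cintegral F : R[i] :=
  (\int[mu]_(t in D) complex.Re (F t))%R +i* (\int[mu]_(t in D) complex.Im (F t))%R.

Definition cintegrable F :=
  mu.-integrable D (EFin \o (fun t => complex.Re (F t))) /\
  mu.-integrable D (EFin \o (fun t => complex.Im (F t))).

Lemma cintegrableD F G : cintegrable F -> cintegrable G -> cintegrable (fun t => F t + G t).
Proof.
move=> [a b] [c d]; split.
  rewrite (_ : (fun t => _) = fun t => complex.Re (F t) + complex.Re (G t)); first exact: Tdom_integrableD.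
  by apply/funext => t; rewrite complexReD.
rewrite (_ : (fun t => _) = fun t => complex.Im (F t) + complex.Im (G t)); first exact: Tdom_integrableD.
by apply/funext => t; rewrite complexImD.
Qed.

Lemma cintegralD F G : cintegrable F -> cintegrable G ->
  cintegral (fun t => F t + G t) = cintegral F + cintegral G.
Proof.
move=> [a b] [c d]; rewrite /cintegral.
under eq_Rintegral do rewrite complexReD.
under [in X in _ +i* X]eq_Rintegral do rewrite complexImD.
by rewrite (Tdom_integralD a c) (Tdom_integralD b d).
Qed.

Lemma cintegrableZ (k : R[i]) F : cintegrable F -> cintegrable (fun t => k * F t).
Proof.
move=> [a b]; split.
  rewrite (_ : (fun t => _) = fun t => complex.Re k * complex.Re (F t) - complex.Im k * complex.Im (F t)).
    by apply: Tdom_integrableB; apply: Tdom_integrableZ.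
  by apply/funext => t; rewrite complexReM.
rewrite (_ : (fun t => _) = fun t => complex.Re k * complex.Im (F t) + complex.Im k * complex.Re (F t)).
  by apply: Tdom_integrableD; apply: Tdom_integrableZ.
by apply/funext => t; rewrite complexImM.
Qed.

Lemma cintegralZ (k : R[i]) F : cintegrable F ->
  cintegral (fun t => k * F t) = k * cintegral F.
Proof.
move=> [a b]; rewrite /cintegral.
under eq_Rintegral do rewrite complexReM.
under [in X in _ +i* X]eq_Rintegral do rewrite complexImM.
rewrite (Tdom_integralB (Tdom_integrableZ _ a) (Tdom_integrableZ _ b)).
rewrite (Tdom_integralD (Tdom_integrableZ _ b) (Tdom_integrableZ _ a)).
rewrite !(Tdom_integralZ _ a) !(Tdom_integralZ _ b).
by case: k => x y; complex_ring.
Qed.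

Lemma cintegralB F G : cintegrable F -> cintegrable G ->
  cintegral (fun t => F t - G t) = cintegral F - cintegral G.
Proof.
move=> hF hG; under [F in cintegral F]eq_fun do rewrite -mulN1r.
by rewrite (cintegralD hF (cintegrableZ _ hG)) cintegralZ // mulN1r.
Qed.

Lemma cintegrableB F G : cintegrable F -> cintegrable G -> cintegrable (fun t => F t - G t).
Proof.
move=> hF hG; under [F in cintegrable F]eq_fun do rewrite -mulN1r.
exact: cintegrableD (cintegrableZ _ hG).
Qed.

Lemma normc_le_ReIm (z : R[i]) : normc z <= `|complex.Re z| + `|complex.Im z|.
Proof.
case: z => a b /=; rewrite -(@ler_sqr R) ?nnegrE ?sqrtr_ge0 ?addr_ge0 //.
rewrite sqr_sqrtr ?addr_ge0 ?sqr_ge0 // sqrrD !real_normK ?num_real //.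
by rewrite lerD2r lerDl mulrn_wge0 // mulr_ge0.
Qed.

(** The factor 2 comes from bounding the real and imaginary parts separately. It does no harm where
    the bound is arbitrarily small or zero. *)
Lemma normc_cintegral_le F (b : R -> R) : cintegrable F -> mu.-integrable D (EFin \o b) ->
  (forall t, normc (F t) <= b t) ->
  normc (cintegral F) <= 2 * (\int[mu]_(t in D) b t)%R.
Proof.
move=> [iR iI] ib Fb; apply: (le_trans (normc_le_ReIm _)); rewrite mulr2n mulrDl !mul1r lerD //=.
  apply: (le_trans (le_normr_Rintegral measurable_Tdom iR)).
  apply: (le_Rintegral measurable_Tdom (Tdom_integrable_norm iR) ib) => t _.
  exact: le_trans (normr_Re_le _) (Fb t).
apply: (le_trans (le_normr_Rintegral measurable_Tdom iI)).
apply: (le_Rintegral measurable_Tdom (Tdom_integrable_norm iI) ib) => t _.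
exact: le_trans (normr_Im_le _) (Fb t).
Qed.

Lemma integrable_continuousM (u phi : R -> R) (B : R) : continuous u ->
  (forall t, `|u t| <= B) -> mu.-integrable D (EFin \o phi) ->
  mu.-integrable D (EFin \o (fun t => u t * phi t)).
Proof.
move=> cu uB iphi.
have mu_u : measurable_fun (D : set (measurableTypeR R)) u.
  by apply: measurable_funTS; exact: continuous_measurable_fun.
have bu : [bounded u x | x in (D : set (measurableTypeR R))].
  exists B; split; first exact: num_real.
  by move=> M BM x _ /=; rewrite (le_trans (uB x)) // ltW.
exact: (integrableMr measurable_Tdom mu_u bu iphi).
Qed.

(** The reflection in [F (- s)] fits both uses: the kernel at t - s and the characters exp (- i n
    s). *)
Lemma cintegrable_disk_approx r F (c : R[i]) phi : disk_approx r F c ->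
  mu.-integrable D (EFin \o phi) -> cintegrable (fun s => F (- s) * (phi s)%:C).
Proof.
move=> hF iphi; have [cr ci] := disk_approx_continuous hF.
have [B B0 [_ FB]] := disk_approx_bounded hF.
split.
  rewrite (_ : (fun s => _) = fun s => complex.Re (F (- s)) * phi s); last first.
    by apply/funext => s; rewrite complexReM /= mulr0 subr0.
  apply: (@integrable_continuousM _ _ B) => // [s|s].
    by apply: (@continuous_comp _ _ _ -%R (fun s => complex.Re (F s))); [exact: opp_continuous|exact: cr].
  exact: le_trans (normr_Re_le _) (FB _).
rewrite (_ : (fun s => _) = fun s => complex.Im (F (- s)) * phi s); last first.
  by apply/funext => s; rewrite complexImM /= mulr0 add0r.
apply: (@integrable_continuousM _ _ B) => // [s|s].
  by apply: (@continuous_comp _ _ _ -%R (fun s => complex.Im (F s))); [exact: opp_continuous|exact: ci].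
exact: le_trans (normr_Im_le _) (FB _).
Qed.

(** Not normalized: a constant k has real part 2 pi k, as [Re_herglotz_cst] shows. *)
Definition herglotz phi r t : R[i] :=
  cintegral (fun s => circle_kernel r (t - s) * (phi s)%:C).

Lemma herglotz_integrable phi r t : 0 <= r < 1 -> mu.-integrable D (EFin \o phi) ->
  cintegrable (fun s => circle_kernel r (t - s) * (phi s)%:C).
Proof.
move=> hr iphi; have := cintegrable_disk_approx (circle_kernel_approx (- t) hr) iphi.
by rewrite (_ : (fun s => _) = (fun s => circle_kernel r (t - s) * (phi s)%:C)) //;
  apply/funext => s; rewrite opprK addrC.
Qed.

(** Integrating the truncated series against phi gives a polynomial in r exp (i t) whose
    coefficients are the unnormalized Fourier coefficients of phi. Integrability is carried along
    because additivity needs it at every step. *)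
Lemma geometric_integral phi r t N : mu.-integrable D (EFin \o phi) ->
  cintegrable (fun s => (\sum_(n < N) (r%:C * expi (t - s)) ^+ n) * (phi s)%:C) /\
  cintegral (fun s => (\sum_(n < N) (r%:C * expi (t - s)) ^+ n) * (phi s)%:C) =
    \sum_(n < N) cintegral (fun s => expi (- s) ^+ n * (phi s)%:C) * (r%:C * expi t) ^+ n.
Proof.
move=> iphi; elim: N => [|N [ih1 ih2]].
  rewrite big_ord0; have -> : (fun s : R => (\sum_(n < 0) (r%:C * expi (t - s)) ^+ n) * (phi s)%:C) = fun=> 0.
    by apply/funext => s; rewrite big_ord0 mul0r.
  split; first by split; exact: (Tdom_integrable_cst 0).
  by rewrite /cintegral /= !Tdom_integral_cst mulr0.
have iN : cintegrable (fun s => expi (- s) ^+ N * (phi s)%:C).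
  have := @cintegrable_disk_approx 1 _ _ phi (disk_approx_poly 1 'X^N) iphi.
  by rewrite (_ : (fun s => _) = (fun s => expi (- s) ^+ N * (phi s)%:C)) //;
    apply/funext => s; rewrite hornerXn mul1r.
have -> : (fun s => (\sum_(n < N.+1) (r%:C * expi (t - s)) ^+ n) * (phi s)%:C) =
    (fun s => (\sum_(n < N) (r%:C * expi (t - s)) ^+ n) * (phi s)%:C +
      (r%:C * expi t) ^+ N * (expi (- s) ^+ N * (phi s)%:C)).
  by apply/funext => s; rewrite big_ord_recr /= mulrDl mulrA -exprMn -mulrA -expiD.
split; first exact/cintegrableD/cintegrableZ.
rewrite (cintegralD ih1 (cintegrableZ _ iN)) ih2 (cintegralZ _ iN) [in RHS]big_ord_recr /=.
by congr (_ + _); rewrite mulrC.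
Qed.

Lemma cintegral_real phi : mu.-integrable D (EFin \o phi) ->
  cintegrable (fun s => (phi s)%:C) /\
  cintegral (fun s => (phi s)%:C) = ((\int[mu]_(s in D) phi s)%R)%:C.
Proof.
move=> iphi; split; first by split=> //; exact: (Tdom_integrable_cst 0).
by rewrite /cintegral /= Tdom_integral_cst mulr0.
Qed.

(** The truncated kernel is uniformly close to the kernel, so its integral against phi, a polynomial
    in r exp (i t), is uniformly close to the Herglotz integral. *)
Lemma herglotz_approx phi r : 0 <= r < 1 -> mu.-integrable D (EFin \o phi) ->
  disk_approx r (herglotz phi r) ((\int[mu]_(s in D) phi s)%R)%:C.
Proof.
move=> hr iphi e e0; have /andP[r0 r1] := hr.
pose I := (\int[mu]_(s in D) `|phi s|)%R.
have I0 : 0 <= I by exact: Rintegral_ge0.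
(* Twice the kernel error 2 r^N / (1 - r) times [I] must be at most e; 1 + [I] in the denominator
   covers [I] = 0. *)
have [||N N0 hN] := @exprn_small R r (e * (1 - r) / (4 * (1 + I))) => //.
  by rewrite divr_gt0 // mulr_gt0 ?subr_gt0 // ltr_pwDl.
have small : 2 * (2 * r ^+ N / (1 - r) * I) <= e.
  move: hN; rewrite ler_pdivlMr; last by rewrite mulr_gt0 // ltr_pwDl.
  have rN : 0 <= r ^+ N by exact: exprn_ge0.
  have -> : 2 * (2 * r ^+ N / (1 - r) * I) = 4 * r ^+ N * I / (1 - r) by ring.
  rewrite ler_pdivrMr ?subr_gt0 //; move: (r ^+ N) rN => x x0 h; nra.
have [ic cE] := cintegral_real iphi.
pose c n := cintegral (fun s => expi (- s) ^+ n * (phi s)%:C).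
pose J := \int[mu]_(s in D) phi s.
exists (2%:P * (\sum_(n < N) (c n)%:P * 'X^n) - (J%:C)%:P).
have pE z : (2%:P * (\sum_(n < N) (c n)%:P * 'X^n) - (J%:C)%:P).[z] =
    2 * (\sum_(n < N) c n * z ^+ n) - J%:C.
  rewrite hornerD hornerN hornerC hornerCM horner_sum; congr (_ * _ - _).
  by apply: eq_bigr => n _; rewrite hornerCM hornerXn.
split=> [t|]; rewrite pE.
  have [i1 e1] := geometric_integral r t N iphi.
  have i2 := cintegrableZ 2 i1; have i3 := herglotz_integrable t hr iphi.
  rewrite -/(herglotz _ _) -e1 -(cintegralZ 2 i1) /J -cE -(cintegralB i2 ic).
  rewrite /herglotz -(cintegralB i3 (cintegrableB i2 ic)).
  apply: le_trans small; rewrite /I -(Tdom_integralZ _ (Tdom_integrable_norm iphi)).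
  apply: normc_cintegral_le.
  - exact: cintegrableB i3 (cintegrableB i2 ic).
  - exact/Tdom_integrableZ/Tdom_integrable_norm.
  - move=> s; set S := \sum_(n < N) _.
    have -> : circle_kernel r (t - s) * (phi s)%:C - (2 * (S * (phi s)%:C) - (phi s)%:C) =
       (circle_kernel r (t - s) - (2 * S - 1)) * (phi s)%:C by ring.
    by rewrite normcM normc_real ler_wpM2r //; exact: circle_kernel_geometric.
(* As [N] is positive, the constant term [c 0] is present; it equals [J], so the value at the origin
   is 2 J - J = J. *)
case: N N0 {hN small pE} => // N _; rewrite big_ord_recl expr0 big1 => [|i _].
  rewrite addr0 mulr1 /c (_ : (fun s => _) = (fun s => (phi s)%:C)) ?cE -/J.
    by rewrite (_ : J%:C - (2 * J%:C - J%:C) = 0) ?normc0 ?ltW //; ring.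
  by apply/funext => s; rewrite expr0 mul1r.
by rewrite expr0n mulr0.
Qed.

End HerglotzIntegral.

(** * Pointwise inequalities for moduli and phases *)

Section PointwiseInequalities.
Set Implicit Arguments.
Unset Strict Implicit.
Context {R : realType}.
Implicit Types (x y s : R).

(* The derivative of the difference is 2 (exp (- s) - 1/2)^2. *)
Lemma sqr_onem_expR_le s : 0 <= s -> (1 - expR (- s)) ^+ 2 <= s / 2.
Proof.
move=> s0.
pose F x : R := x / 2 - (1 - expR (- x)) ^+ 2.
have dF x : is_derive x 1 F (2 * (expR (- x) - 1 / 2) ^+ 2).
  by apply: is_derive_eq; rewrite /GRing.scale /=; move: (expR _) => z; field.
have cF : continuous F.
  by move=> u; apply/differentiable_continuous/derivable1_diffP.
have [c _] := MVT_segment s0 (fun x _ => dF x) (continuous_subspaceT cF).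
have -> : F 0 = 0 by rewrite /F oppr0 expR0 subrr expr0n /= mul0r subr0.
rewrite !subr0 /F => e.
by rewrite -subr_ge0 e mulr_ge0 // mulr_ge0 // sqr_ge0.
Qed.

(** Factoring out the larger exponential, which is at most 1, leaves 1 - exp (- |x - y|). *)
Lemma sqr_expR_sub_le x y : x <= 0 -> y <= 0 ->
  (expR x - expR y) ^+ 2 <= `|x - y| / 2.
Proof.
wlog xy : x y / x <= y => [wl x0 y0|x0 y0].
  case: (leP x y) => [xy|/ltW yx]; first exact: wl.
  by rewrite -sqrrN opprB distrC; exact: wl.
have -> : expR x = expR y * expR (- (y - x)).
  by rewrite -expRD; congr expR; ring.
rewrite (_ : _ - _ = - (expR y * (1 - expR (- (y - x))))); last by ring.
rewrite sqrrN exprMn distrC ger0_norm ?subr_ge0 //.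
apply: le_trans (sqr_onem_expR_le _); last by rewrite subr_ge0.
by rewrite ler_piMl ?sqr_ge0 // expr_le1 ?expR_ge0 // expR_le1.
Qed.

(** The case M = 1: x and y stand for the logarithms of the two moduli and k for 1 minus the cosine
    of the phase difference, so the left side is |f_r - g_r|^2 by [csqnorm_cexpB]. *)
Lemma spectral_pointwise_normalized x y k : x <= 0 -> 0 <= k <= 2 ->
  (expR x - expR y) ^+ 2 + 2 * (expR x * expR y) * k <=
  2 * Num.max (expR y ^+ 2 - 1) 0 + `|x - y| / 2 + 2 * k.
Proof.
move=> x0 /andP[k0 k2]; have p0 := expR_gt0 x; have q0 := expR_gt0 y.
have p1 : expR x <= 1 by rewrite expR_le1.
case: (leP y 0) => [y0|y0].
  have q1 : expR y <= 1 by rewrite expR_le1.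
  have h := sqr_expR_sub_le x0 y0.
  have m0 : 0 <= Num.max (expR y ^+ 2 - 1) 0 by rewrite le_max lexx orbT.
  have : expR x * expR y * k <= k by rewrite ler_piMl // mulr_ile1 // ltW.
  by rewrite -mulrA; lra.
have q1 : 1 < expR y by rewrite expR_gt1.
have -> : Num.max (expR y ^+ 2 - 1) 0 = expR y ^+ 2 - 1.
  by rewrite max_l // subr_ge0 expr_ge1 // ltW.
have dx : x <= 0 -> - x / 2 <= `|x - y| / 2 by rewrite distrC ger0_norm ?subr_ge0; lra.
have h : (1 - expR x) ^+ 2 <= `|x - y| / 2.
  have := @sqr_onem_expR_le (- x); rewrite opprK; lra.
move: h p0 p1 q0 q1; set p := expR x; set q := expR y; set d := `|x - y|.
move=> h p0 p1 q0 q1; have p1' : 0 <= 1 - p by lra.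
have q1' : 0 <= q - 1 by lra.
(* If p q >= 1, the excess 2 (p q - 1) k is largest at k = 2, and it remains to see (p + q)^2 - 4 <=
   2 (q^2 - 1). Otherwise p q k <= k, and (p - q)^2 = (1 - p)^2 + (q^2 - 1) - 2 p (q - 1). *)
case: (leP 1 (p * q)) => pq.
  have h1 : 0 <= (p * q - 1) * (2 - k) by rewrite mulr_ge0; lra.
  have h2 : 0 <= (q - 1) ^+ 2 by exact: sqr_ge0.
  have h3 : 0 <= (1 - p) * q by rewrite mulr_ge0 // ltW.
  have h4 : 0 <= (1 - p) * (1 + p) by rewrite mulr_ge0 //; lra.
  have d0 : 0 <= d by exact: normr_ge0.
  by move: h1 h2 h3 h4 d0; lra.
have h1 : p * q * k <= k by rewrite ler_piMl // ltW.
have h2 : 0 <= p * (q - 1) by rewrite mulr_ge0 // ltW.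
have h3 : 0 <= (q - 1) * (q + 1) by rewrite mulr_ge0 //; lra.
by move: h h1 h2 h3; lra.
Qed.

(** Dividing both moduli by sqrt M = [expR c] reduces to M = 1, with x - y and k unchanged. *)
Lemma spectral_pointwise (M x y k : R) : 0 < M -> expR x ^+ 2 <= M -> 0 <= k <= 2 ->
  (expR x - expR y) ^+ 2 + 2 * (expR x * expR y) * k <=
  2 * Num.max (expR y ^+ 2 - M) 0 + M * `|x - y| / 2 + 2 * M * k.
Proof.
move=> M0 xM k02; pose c := ln M / 2.
have cM : expR c ^+ 2 = M.
  by rewrite -expRM_natl /c mulrC divfK // lnK.
have x0 : x - c <= 0.
  by rewrite subr_le0 -ler_expR -ler_sqr ?nnegrE ?expR_ge0 // cM.
have := @spectral_pointwise_normalized (x - c) (y - c) k x0 k02.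
have eE u : expR u = expR c * expR (u - c) by rewrite -expRD; congr expR; ring.
rewrite (eE x) (eE y); have -> : x - c - (y - c) = x - y by ring.
set p := expR (x - c); set q := expR (y - c) => h.
have -> : Num.max ((expR c * q) ^+ 2 - M) 0 = M * Num.max (q ^+ 2 - 1) 0.
  by rewrite exprMn cM maxr_pMr ?ltW // mulr0 mulrBr mulr1.
have := ler_wpM2l (ltW M0) h; rewrite -cM; set e := expR c; lra.
Qed.

(** The law of cosines, arranged to separate the moduli from the phases. *)
Lemma csqnorm_cexpB (w z : R[i]) : csqnorm (cexp w - cexp z) =
  (expR (complex.Re w) - expR (complex.Re z)) ^+ 2 +
  2 * (expR (complex.Re w) * expR (complex.Re z)) * (1 - cos (complex.Im w - complex.Im z)).
Proof.
case: w z => a a' [b b']; rewrite /csqnorm /cexp /expi complexReB complexImB.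
rewrite !(complexReM, complexImM) /= cosB !mul0r !subr0 !addr0.
have c1 := cos2Dsin2 a'; have c2 := cos2Dsin2 b'.
set p := expR a; set q := expR b.
transitivity (p ^+ 2 * (cos a' ^+ 2 + sin a' ^+ 2) + q ^+ 2 * (cos b' ^+ 2 + sin b' ^+ 2)
  - 2 * p * q * (cos a' * cos b' + sin a' * sin b')); first by ring.
by rewrite c1 c2; ring.
Qed.

(* With X = exp (- (a + i a')) and Y = exp (- (b + i b')), this combines
   1 - cos (a' - b') <= (a + b) / 4 + 2 - |X + Y|^2 / 2 with
   |X + Y|^2 >= 2 m Re (X + Y) - m^2, whose right-hand side is linear in X + Y. *)
Lemma onem_cos_sub_le (a b a' b' m : R) : 0 <= a -> 0 <= b ->
  1 - cos (a' - b') <= (a + b) / 4 + 2 + m ^+ 2 / 2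
    - m * (complex.Re (cexp (- (a +i* a'))) + complex.Re (cexp (- (b +i* b')))).
Proof.
move=> a0 b0; rewrite !complexReM /= cosN sinN cosN sinN cosB !mul0r !subr0.
have Na : - a <= 0 by lra. have Nb : - b <= 0 by lra.
have h := sqr_expR_sub_le Na Nb.
have hab : `|- a - - b| <= a + b.
  by rewrite opprK addrC (le_trans (ler_normB _ _)) // !ger0_norm // addrC.
have p1 : expR (- a) <= 1 by rewrite expR_le1.
have q1 : expR (- b) <= 1 by rewrite expR_le1.
move: h p1 q1 (expR_ge0 (- a)) (expR_ge0 (- b)).
set p := expR (- a); set q := expR (- b) => h p1 q1 p0 q0.
have c1 := cos2Dsin2 a'; have c2 := cos2Dsin2 b'.
have c3 := cos_geN1 (a' - b'); rewrite cosB in c3.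
set ca := cos a' in c1 c3 *; set sa := sin a' in c1 c3 *.
set cb := cos b' in c2 c3 *; set sb := sin b' in c2 c3 *.
(* A cosine is at least -1, so replacing the cosine C by p q C costs at most 1 - p q, and 1 - C <= 2
   - p q - p q C. *)
have hc : (1 - p * q) * (ca * cb + sa * sb) >= - (1 - p * q).
  have : 0 <= (1 - p * q) * (ca * cb + sa * sb + 1).
    by rewrite mulr_ge0 ?subr_ge0 ?mulr_ile1 //; lra.
  lra.
(* This is |X + Y - m|^2 >= 0, which linearizes |X + Y|^2 at the real number m. *)
have hm : 0 <= (p * ca + q * cb - m) ^+ 2 + (p * sa + q * sb) ^+ 2.
  by rewrite addr_ge0 ?sqr_ge0.
have e1 : (p * ca + q * cb - m) ^+ 2 + (p * sa + q * sb) ^+ 2 =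
   p ^+ 2 * (ca ^+ 2 + sa ^+ 2) + q ^+ 2 * (cb ^+ 2 + sb ^+ 2)
   + 2 * (p * q * (ca * cb + sa * sb)) - 2 * m * (p * ca + q * cb) + m ^+ 2 by ring.
rewrite e1 c1 c2 in hm.
have arith (C S d : R) : (p - q) ^+ 2 <= d / 2 -> d <= a + b ->
    - (1 - p * q) <= (1 - p * q) * C ->
    0 <= p ^+ 2 * 1 + q ^+ 2 * 1 + 2 * (p * q * C) - 2 * m * S + m ^+ 2 ->
    1 - C <= (a + b) / 4 + 2 + m ^+ 2 / 2 - m * S.
  by clear; lra.
exact: arith h hab hc hm.
Qed.

End PointwiseInequalities.

(** * The inequality on a circle of radius r < 1 *)

Section SpectralFactorOnCircles.
Set Implicit Arguments.
Unset Strict Implicit.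
Context {R : realType}.
Notation mu := (@lebesgue_measure R).
Notation D := (@Tdom R).
Implicit Types (r s t : R) (phi psi : R -> R).

Lemma ae_imp (P Q : R -> Prop) : {ae mu, forall s : R, P s} -> (forall s, P s -> Q s) ->
  {ae mu, forall s : R, Q s}.
Proof. by move=> hP PQ; apply: (@filterS _ _ (ae_filter_ringOfSetsType mu) _ _ PQ hP). Qed.

Lemma ae_imp2 (P Q S : R -> Prop) : {ae mu, forall s : R, P s} -> {ae mu, forall s : R, Q s} ->
  (forall s, P s -> Q s -> S s) -> {ae mu, forall s : R, S s}.
Proof.
by move=> hP hQ PQS; apply: (@filterS2 _ _ (ae_filter_ringOfSetsType mu) _ _ _ PQS hP hQ).
Qed.

Lemma ae_all (P : R -> Prop) : (forall s, P s) -> {ae mu, forall s : R, P s}.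
Proof. by move=> hP; exact: (@aeW _ (measurableTypeR R) R mu P). Qed.

Lemma complexReZ (k : R) (z : R[i]) : complex.Re (k%:C * z) = k * complex.Re z.
Proof. by rewrite complexReM /= mul0r subr0. Qed.

Lemma csqnormB (z w : R[i]) : csqnorm (z - w) =
  (complex.Re z - complex.Re w) * (complex.Re z - complex.Re w) +
  (complex.Im z - complex.Im w) * (complex.Im z - complex.Im w).
Proof. by case: z w => a b [c d]; rewrite /csqnorm /= !expr2. Qed.

Lemma cexp_real (x : R) : cexp x%:C = (expR x)%:C.
Proof. by rewrite /cexp /= expi0 mulr1. Qed.

Lemma herglotzB phi psi r t : 0 <= r < 1 ->
  mu.-integrable D (EFin \o phi) -> mu.-integrable D (EFin \o psi) ->
  herglotz (fun s => phi s - psi s) r t = herglotz phi r t - herglotz psi r t.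
Proof.
move=> hr ip iq.
rewrite /herglotz -(cintegralB (herglotz_integrable t hr ip) (herglotz_integrable t hr iq)).
by congr cintegral; apply/funext => s; rewrite -mulrBr rmorphB.
Qed.

(** Serves the case of an unbounded f with log f = log g almost everywhere, where the product of the
    two norms is 0 by convention. *)
Lemma herglotz_eq0 phi r t : 0 <= r < 1 -> mu.-integrable D (EFin \o phi) ->
  (\int[mu]_(s in D) `|phi s| = 0)%R -> herglotz phi r t = 0.
Proof.
move=> hr ip phi0; have [B B0 [_ KB]] := disk_approx_bounded (circle_kernel_approx 0 hr).
have ia := Tdom_integrable_norm ip.
apply: eq0_normc; apply/le_anti; rewrite normc_ge0 andbT.
have := normc_cintegral_le (herglotz_integrable t hr ip) (Tdom_integrableZ B ia).
rewrite (Tdom_integralZ B ia) phi0 !mulr0; apply => s.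
by rewrite normcM normc_real ler_wpM2r // -[t - s]subr0.
Qed.

Lemma Re_herglotzE phi r t : complex.Re (herglotz phi r t) =
  (\int[mu]_(s in D) (complex.Re (circle_kernel r (t - s)) * phi s))%R.
Proof. by apply: eq_Rintegral => s _; rewrite complexReM /= mulr0 subr0. Qed.

Lemma Re_herglotz_integrable phi r t : 0 <= r < 1 -> mu.-integrable D (EFin \o phi) ->
  mu.-integrable D (EFin \o (fun s => complex.Re (circle_kernel r (t - s)) * phi s)).
Proof.
move=> hr ip; have [+ _] := herglotz_integrable t hr ip.
by rewrite (_ : (fun s => _) = (fun s => complex.Re (circle_kernel r (t - s)) * phi s)) //;
  apply/funext => s; rewrite complexReM /= mulr0 subr0.
Qed.

(** The Poisson kernel is even, so the integral over s falls under the mean value property of the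
    kernel, whose value at the center is 1. *)
Lemma Re_herglotz_cst (k r t : R) : 0 <= r < 1 ->
  complex.Re (herglotz (fun=> k) r t) = 2 * pi * k.
Proof.
move=> hr; rewrite Re_herglotzE.
have E s : complex.Re (circle_kernel r (t - s)) * k = k * complex.Re (circle_kernel r (s - t)).
  by rewrite mulrC -opprB circle_kernel_Re_even.
under eq_Rintegral do rewrite E.
have h := circle_kernel_approx t hr.
rewrite (Tdom_integralZ k (continuous_integrable_Tdom (disk_approx_continuous h).1)).
by rewrite (disk_approx_integral h) /= mulr1 mulrC.
Qed.

Lemma ae_eq_Tdom_integral (u v : R -> R) :
  mu.-integrable D (EFin \o u) -> mu.-integrable D (EFin \o v) ->
  {ae mu, forall s : R, D s -> u s = v s} ->
  (\int[mu]_(s in D) u s = \int[mu]_(s in D) v s)%R.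
Proof.
move=> iu iv uv; congr fine; apply: (@ae_eq_integral _ _ _ mu D _ _ measurable_Tdom).
- exact: measurable_int iu.
- exact: measurable_int iv.
- by apply: (ae_imp uv) => s us Ds; rewrite /= us.
Qed.

(** A difference that is nonnegative almost everywhere agrees almost everywhere with its absolute
    value, whose integral is nonnegative. *)
Lemma ae_le_Tdom_integral (u v : R -> R) :
  mu.-integrable D (EFin \o u) -> mu.-integrable D (EFin \o v) ->
  {ae mu, forall s : R, D s -> u s <= v s} ->
  (\int[mu]_(s in D) u s <= \int[mu]_(s in D) v s)%R.
Proof.
move=> iu iv uv; rewrite -subr_ge0 -(Tdom_integralB iv iu).
have id := Tdom_integrableB iv iu.
rewrite (ae_eq_Tdom_integral id (Tdom_integrable_norm id)); first exact: Rintegral_ge0.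
by apply: (ae_imp uv) => s h Ds; rewrite ger0_norm // subr_ge0 h.
Qed.

Lemma Re_herglotz_le phi psi r t : 0 <= r < 1 ->
  mu.-integrable D (EFin \o phi) -> mu.-integrable D (EFin \o psi) ->
  {ae mu, forall s : R, D s -> phi s <= psi s} ->
  complex.Re (herglotz phi r t) <= complex.Re (herglotz psi r t).
Proof.
move=> hr ip iq le; rewrite -subr_ge0 -complexReB -(herglotzB t hr iq ip).
have id := Tdom_integrableB iq ip; have ia := Tdom_integrable_norm id.
rewrite Re_herglotzE.
rewrite (@ae_eq_Tdom_integral _ (fun s => complex.Re (circle_kernel r (t - s)) * `|psi s - phi s|)).
- by apply: Rintegral_ge0 => s _; rewrite mulr_ge0 // circle_kernel_Re_ge0.
- exact: Re_herglotz_integrable.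
- exact: Re_herglotz_integrable.
- by apply: (ae_imp le) => s h Ds; rewrite ger0_norm // subr_ge0 h.
Qed.

(** Jensen's inequality for the convex function x -> max (exp x - M, 0) of ln g; 2 pi is the total
    mass of the unnormalized kernel. The two arguments of the maximum are bounded separately. *)
Lemma Re_herglotz_jensen (g : R -> R) (M r t : R) : 0 <= r < 1 -> 0 <= M ->
  mu.-integrable D (EFin \o g) -> mu.-integrable D (EFin \o (fun s => ln (g s))) ->
  mu.-integrable D (EFin \o (fun s => Num.max (g s - M) 0)) ->
  {ae mu, forall s : R, D s -> 0 < g s} ->
  2 * pi * Num.max (expR (complex.Re (herglotz (fun s => ln (g s)) r t) / (2 * pi)) - M) 0
   <= complex.Re (herglotz (fun s => Num.max (g s - M) 0) r t).
Proof.
move=> hr M0 ig il im g0; have p0 := @pi_gt0 R; have p2 : 0 < 2 * pi :> R by rewrite mulr_gt0.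
set b := _ / (2 * pi).
rewrite maxr_pMr ?(ltW p2) // mulr0 ge_max; apply/andP; split; last first.
  have := Re_herglotz_le t hr (Tdom_integrable_cst 0) im.
  rewrite (Re_herglotz_cst 0 t hr) mulr0; apply.
  by apply: ae_all => s _; rewrite le_max lexx orbT.
(* The tangent line of exp at b lies below exp and has Poisson integral exp b. *)
pose tangent s := (expR b * (1 - b) - M) + expR b * ln (g s).
have i1 := Tdom_integrable_cst (expR b * (1 - b) - M).
have i2 := Tdom_integrableZ (- expR b) il.
have ti : mu.-integrable D (EFin \o tangent).
  by apply: Tdom_integrableD => //; exact: Tdom_integrableZ.
have tE : complex.Re (herglotz tangent r t) = 2 * pi * (expR b - M).
  have -> : tangent = fun s => (expR b * (1 - b) - M) - (- expR b) * ln (g s).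
    by apply/funext => s; rewrite mulNr opprK.
  rewrite (herglotzB t hr i1 i2) complexReB (Re_herglotz_cst _ t hr).
  rewrite [X in _ - X]Re_herglotzE.
  have E s : complex.Re (circle_kernel r (t - s)) * (- expR b * ln (g s)) =
     - expR b * (complex.Re (circle_kernel r (t - s)) * ln (g s)) by ring.
  under eq_Rintegral do rewrite E.
  rewrite (Tdom_integralZ _ (Re_herglotz_integrable t hr il)) -Re_herglotzE.
  have -> : complex.Re (herglotz (fun s => ln (g s)) r t) = 2 * pi * b.
    by rewrite /b mulrC divfK // gt_eqF.
  by ring.
rewrite -tE; apply: (Re_herglotz_le t hr ti im).
apply: (ae_imp g0) => s gs Ds; rewrite le_max; apply/orP; left.
have := expR_ge1Dx (ln (g s) - b); rewrite expRD lnK ?posrE ?gs // expRN.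
rewrite -(ler_pM2l (expR_gt0 b)) mulrCA divff ?mulr1; last by rewrite gt_eqF ?expR_gt0.
by rewrite /tangent; lra.
Qed.

(** The factor 1 / (4 pi) is half the Poisson normalization 1 / (2 pi), because f is the square of
    the modulus of its spectral factor. *)
Definition log_outer (f : R -> R) r t : R[i] :=
  (1 / (4 * pi))%:C * herglotz (fun s => ln (f s)) r t.

Lemma csqnorm_log_outer_integrable (f g : R -> R) r : 0 <= r < 1 ->
  mu.-integrable D (EFin \o (fun s => ln (f s))) ->
  mu.-integrable D (EFin \o (fun s => ln (g s))) ->
  mu.-integrable D (EFin \o (fun t => csqnorm (cexp (log_outer f r t) - cexp (log_outer g r t)))).
Proof.
move=> hr ilf ilg; pose F := log_outer f r; pose G := log_outer g r.
have cont w c : disk_approx r w c ->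
  continuous (fun t => complex.Re (cexp (w t))) /\ continuous (fun t => complex.Im (cexp (w t))).
by move=> hw; exact: disk_approx_continuous (disk_approx_cexp hw).
have apF : disk_approx r F _ := disk_approxZ (1 / (4 * pi))%:C (herglotz_approx hr ilf).
have apG : disk_approx r G _ := disk_approxZ (1 / (4 * pi))%:C (herglotz_approx hr ilg).
have [cF1 cF2] := cont _ _ apF; have [cG1 cG2] := cont _ _ apG.
rewrite (_ : (fun t => csqnorm _) = fun t =>
  (complex.Re (cexp (F t)) - complex.Re (cexp (G t))) *
  (complex.Re (cexp (F t)) - complex.Re (cexp (G t))) +
  (complex.Im (cexp (F t)) - complex.Im (cexp (G t))) *
  (complex.Im (cexp (F t)) - complex.Im (cexp (G t)))); last first.
  by apply/funext => t; rewrite csqnormB.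
have cR : continuous (fun t => complex.Re (cexp (F t)) - complex.Re (cexp (G t))).
  by move=> t; apply: cvgB; [exact: cF1|exact: cG1].
have cI : continuous (fun t => complex.Im (cexp (F t)) - complex.Im (cexp (G t))).
  by move=> t; apply: cvgB; [exact: cF2|exact: cG2].
apply: continuous_integrable_Tdom => t.
by apply: cvgD; apply: cvgM; [exact: cR|exact: cR|exact: cI|exact: cI].
Qed.

(** Here q is the excess of |g_r|^2 over M, H the Herglotz real part dominating it, d the difference
    of log-moduli, c is 1 minus the cosine, S = Re (A + B), and Z = Re (X + Y). *)
Lemma spectral_bound_arith (M q d c S H m k Z : R) : 0 <= M ->
  q <= 2 * k * H -> d <= S -> c <= S / 4 + 2 + m ^+ 2 / 2 - m * Z ->
  2 * q + M * d / 2 + 2 * M * c <=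
    4 * k * H + M * S - 2 * M * m * Z + 2 * M * (2 + m ^+ 2 / 2).
Proof.
move=> M0 h1 h2 h3; have := ler_wpM2l M0 h2; have := ler_wpM2l M0 h3; lra.
Qed.

(** The squared difference is dominated by a constant plus Re [Phi], with [Phi] in the disk algebra,
    so the mean value property integrates the majorant exactly. *)
Lemma spectral_circle_bound (f g : R -> R) (M r : R) : 0 <= r < 1 -> 0 < M ->
  mu.-integrable D (EFin \o f) -> mu.-integrable D (EFin \o g) ->
  mu.-integrable D (EFin \o (fun s => ln (f s))) ->
  mu.-integrable D (EFin \o (fun s => ln (g s))) ->
  mu.-integrable D (EFin \o (fun s => Num.max (g s - M) 0)) ->
  {ae mu, forall s : R, D s -> 0 < f s <= M} ->
  {ae mu, forall s : R, D s -> 0 < g s} ->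
  (\int[mu]_(t in D) csqnorm (cexp (log_outer f r t) - cexp (log_outer g r t)))%R <=
    2 * (\int[mu]_(s in D) `|f s - g s|)%R
    + 5 / 2 * M * (\int[mu]_(s in D) `|ln (f s) - ln (g s)|)%R.
Proof.
move=> hr M0 if_ ig ilf ilg im f0M g0.
have p0 := @pi_gt0 R.
(* [kp] inserts the factor 4 pi k = 1, after which [k] and pi can be treated as independent in
   polynomial identities. *)
have [k [kE k0 kp]] : exists k : R, [/\ k = 1 / (4 * pi), 0 < k & forall x, x = k * (4 * pi) * x].
  exists (1 / (4 * pi)); split=> // [|x]; first by rewrite divr_gt0 // mulr_gt0.
  by rewrite divfK ?mul1r // gt_eqF // mulr_gt0.
pose F := log_outer f r; pose G := log_outer g r.
pose h s := ln (f s) - ln (g s).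
pose hp s := Num.max (h s) 0; pose hn s := Num.max (- h s) 0.
have ih : mu.-integrable D (EFin \o h) by exact: Tdom_integrableB.
have ihabs := Tdom_integrable_norm ih.
have hpE : hp = fun s => 1 / 2 * (`|h s| + h s).
  apply/funext => s; rewrite /hp; case: (leP (h s) 0) => hs; last by rewrite gtr0_norm //; lra.
  by rewrite ler0_norm //; lra.
have hnE : hn = fun s => 1 / 2 * (`|h s| - h s).
  apply/funext => s; rewrite /hn; case: (leP (- h s) 0) => hs.
    by rewrite ger0_norm; lra.
  by rewrite ltr0_norm; lra.
have ihp : mu.-integrable D (EFin \o hp).
  by rewrite hpE; apply: Tdom_integrableZ; exact: Tdom_integrableD.
have ihn : mu.-integrable D (EFin \o hn).
  by rewrite hnE; apply: Tdom_integrableZ; exact: Tdom_integrableB.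
pose A t := k%:C * herglotz hp r t; pose B t := k%:C * herglotz hn r t.
pose al := k * \int[mu]_(s in D) hp s; pose be := k * \int[mu]_(s in D) hn s.
have albe : al + be = k * \int[mu]_(s in D) `|h s|.
  rewrite /al /be -mulrDr -(Tdom_integralD ihp ihn); congr (_ * _).
  by apply: eq_Rintegral => s _; rewrite hpE hnE; lra.
have hE : (fun s => ln (f s) - ln (g s)) = (fun s => hp s - hn s).
  by rewrite hpE hnE; apply/funext => s; rewrite -[LHS]/(h s); move: (h s) => x; field.
have FG t : F t - G t = A t - B t.
  rewrite /F /G /log_outer -kE /A /B -!mulrBr -(herglotzB t hr ilf ilg) hE.
  by rewrite (herglotzB t hr ihp ihn).
have ReF t : complex.Re (F t) = k * complex.Re (herglotz (fun s => ln (f s)) r t).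
  by rewrite /F /log_outer -kE complexReM /= mul0r subr0.
have ReG t : complex.Re (G t) = k * complex.Re (herglotz (fun s => ln (g s)) r t).
  by rewrite /G /log_outer -kE complexReM /= mul0r subr0.
have nneg phi t : mu.-integrable D (EFin \o phi) -> (forall s, 0 <= phi s) ->
    0 <= complex.Re (k%:C * herglotz phi r t).
  move=> ip phi0; rewrite complexReM /= mul0r subr0 mulr_ge0 ?(ltW k0) //.
  have := Re_herglotz_le t hr (Tdom_integrable_cst 0) ip.
  by rewrite (Re_herglotz_cst 0 t hr) mulr0; apply; apply: ae_all => s _.
have a0 t : 0 <= complex.Re (A t).
  by apply: nneg => // s; rewrite /hp le_max lexx orbT.
have b0 t : 0 <= complex.Re (B t).
  by apply: nneg => // s; rewrite /hn le_max lexx orbT.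
pose q := fun s => Num.max (g s - M) 0.
pose J := \int[mu]_(s in D) q s.
(* [m] is the value of X + Y at the center, so the linearization of |X + Y|^2 at [m] loses nothing
   in the mean: it still gives m^2. *)
pose m := expR (- al) + expR (- be).
pose Phi t := (4 * k)%:C * herglotz q r t + M%:C * (A t + B t)
  + (- (2 * M * m))%:C * (cexp (-1 * A t) + cexp (-1 * B t)).
have apA : disk_approx r A al%:C.
  by rewrite /al rmorphM; apply: disk_approxZ; exact: herglotz_approx.
have apB : disk_approx r B be%:C.
  by rewrite /be rmorphM; apply: disk_approxZ; exact: herglotz_approx.
clearbody A B.
have apPhi : disk_approx r Phi ((4 * k)%:C * J%:C + M%:C * (al%:C + be%:C)
   + (- (2 * M * m))%:C * (cexp (-1 * al%:C) + cexp (-1 * be%:C))).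
  apply: disk_approxD.
    by apply: disk_approxD; apply: disk_approxZ; [exact: herglotz_approx|exact: disk_approxD].
  by apply: disk_approxZ; apply: disk_approxD; apply: disk_approx_cexp; apply: disk_approxZ.
have ptw t : csqnorm (cexp (F t) - cexp (G t)) <=
    complex.Re (Phi t) + 2 * M * (2 + m ^+ 2 / 2).
  (* The bound ln f <= ln M passes to Poisson integrals. *)
  have xM : expR (complex.Re (F t)) ^+ 2 <= M.
    rewrite -expRM_natl -[leRHS]lnK // ler_expR ReF.
    have : complex.Re (herglotz (fun s => ln (f s)) r t) <= 2 * pi * ln M.
      rewrite -(Re_herglotz_cst (ln M) t hr).
      apply: (Re_herglotz_le t hr ilf (Tdom_integrable_cst (ln M))).
      apply: (ae_imp f0M) => s fs Ds; have /andP[fs0 fsM] := fs Ds.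
      by rewrite ler_ln.
    move/(ler_wpM2l (ltW k0)) => le1.
    have -> : ln M = 2 * (k * (2 * pi * ln M)) by rewrite [LHS]kp; ring.
    by rewrite ler_pM2l.
  have k02 : 0 <= 1 - cos (complex.Im (F t) - complex.Im (G t)) <= 2.
    by have := cos_le1 (complex.Im (F t) - complex.Im (G t));
      have := cos_geN1 (complex.Im (F t) - complex.Im (G t)); lra.
  rewrite csqnorm_cexpB; apply: (le_trans (spectral_pointwise _ M0 xM k02)).
  have mx : Num.max (expR (complex.Re (G t)) ^+ 2 - M) 0 <= 2 * k * complex.Re (herglotz q r t).
    have := Re_herglotz_jensen t hr (ltW M0) ig ilg im g0.
    have -> : expR (complex.Re (G t)) ^+ 2 =
        expR (complex.Re (herglotz (fun s => ln (g s)) r t) / (2 * pi)).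
      rewrite -expRM_natl ReG; congr expR; set H := complex.Re _.
      by rewrite kE; move: (pi) p0 => p p1; field; rewrite gt_eqF.
    have k2 : 0 <= 2 * k by rewrite mulr_ge0 // ltW.
    move/(ler_wpM2l k2) => le1; apply: le_trans le1.
    by rewrite le_eqVlt [X in X == _]kp; apply/orP; left; apply/eqP; ring.
  have dx : `|complex.Re (F t) - complex.Re (G t)| <= complex.Re (A t) + complex.Re (B t).
    rewrite -complexReB FG complexReB (le_trans (ler_normB _ _)) //.
    by rewrite !ger0_norm.
  have dc : 1 - cos (complex.Im (F t) - complex.Im (G t)) <=
      (complex.Re (A t) + complex.Re (B t)) / 4 + 2 + m ^+ 2 / 2
      - m * (complex.Re (cexp (-1 * A t)) + complex.Re (cexp (-1 * B t))).
    rewrite -complexImB FG complexImB !mulN1r; move: (a0 t) (b0 t).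
    by case: (A t) (B t) => [u v] [u' v'] /= u0 u'0; exact: onem_cos_sub_le.
  have -> : complex.Re (Phi t) = 4 * k * complex.Re (herglotz q r t)
     + M * (complex.Re (A t) + complex.Re (B t))
     - 2 * M * m * (complex.Re (cexp (-1 * A t)) + complex.Re (cexp (-1 * B t))).
    by rewrite /Phi !(complexReD, complexReZ); ring.
  exact: spectral_bound_arith (ltW M0) mx dx dc.
have icsq := csqnorm_log_outer_integrable hr ilf ilg.
have iPhi := continuous_integrable_Tdom (disk_approx_continuous apPhi).1.
apply: (@le_trans _ _ (\int[mu]_(t in D) (complex.Re (Phi t) + 2 * M * (2 + m ^+ 2 / 2)))%R).
  by apply: (le_Rintegral measurable_Tdom icsq _ (fun t _ => ptw t)); apply: Tdom_integrableD => //; exact: Tdom_integrable_cst.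
rewrite (Tdom_integralD iPhi (Tdom_integrable_cst _)) Tdom_integral_cst (disk_approx_integral apPhi).
have -> : complex.Re ((4 * k)%:C * J%:C + M%:C * (al%:C + be%:C)
   + (- (2 * M * m))%:C * (cexp (-1 * al%:C) + cexp (-1 * be%:C))) =
   4 * k * J + M * (al + be) - 2 * M * m * m.
  rewrite !mulN1r -!rmorphN !cexp_real !(complexReD, complexReZ) /= -/m.
  by ring.
(* As f <= M almost everywhere, g - M <= g - f. *)
have J_le : J <= \int[mu]_(s in D) `|f s - g s|.
  apply: ae_le_Tdom_integral => //; first exact/Tdom_integrable_norm/Tdom_integrableB.
  apply: (ae_imp f0M) => s fs Ds; have /andP[_ fM] := fs Ds.
  rewrite ge_max normr_ge0 andbT distrC (le_trans _ (ler_norm _)) //; lra.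
(* From m^2 >= 4 m - 4 and m >= 2 - (al + be). The terms with factor M integrate to 2 pi M (al + be
   + 4 - m^2), hence to at most 10 pi M (al + be), which is 5/2 M times the integral of |h|. *)
have m2 : 4 - 4 * (al + be) <= m ^+ 2.
  have := expR_ge1Dx (- al); have := expR_ge1Dx (- be); rewrite -/m.
  have : 0 <= (m - 2) ^+ 2 by exact: sqr_ge0.
  by rewrite /m; set x := expR (- al); set y := expR (- be); nra.
rewrite -/(h _) (_ : (\int[mu]_(s in D) `|ln (f s) - ln (g s)|)%R = \int[mu]_(s in D) `|h s|) //.
have -> : 5 / 2 * M * \int[mu]_(s in D) `|h s| = 10 * pi * M * (al + be).
  by rewrite albe [LHS]kp; field.
have e : 2 * pi * (4 * k * J) = 2 * J by rewrite [RHS]kp; ring.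
have := ler_wpM2l (mulr_ge0 (ltW p0) (ltW M0)) m2.
move: (pi) e => p e hm.
have -> : 2 * p * (4 * k * J + M * (al + be) - 2 * M * m * m) = 2 * J + 2 * p * (M * (al + be) - 2 * M * m * m).
  by rewrite -e; ring.
clear -hm J_le; lra.
Qed.

End SpectralFactorOnCircles.

(** * Boundary values *)

Section PeriodicShift.
Set Implicit Arguments.
Unset Strict Implicit.
Context {R : realType}.
Notation mu := (@lebesgue_measure R).
Notation D := (@Tdom R).

(** By uniqueness of Lebesgue measure, it suffices to compare lengths of half-open intervals. *)
Lemma lebesgue_measure_shift (c : R) (A : set (measurableTypeR R)) : measurable A ->
  pushforward mu ((fun t => t + c) : measurableTypeR R -> measurableTypeR R) A = mu A.
Proof.
have mshift : measurable_fun setT ((fun t => t + c) : measurableTypeR R -> measurableTypeR R).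
  by apply: continuous_measurable_fun => t; apply: cvgD; [exact: cvg_id|exact: cvg_cst].
move=> mA; apply/esym.
pose sm : {mfun measurableTypeR R >-> measurableTypeR R} :=
  HB.pack ((fun t => t + c) : measurableTypeR R -> measurableTypeR R)
    (isMeasurableFun.Build _ _ _ _ _ mshift).
rewrite -[pushforward _ _]/(pushforward mu sm).
apply: lebesgue_measure_unique => //= _ [[a b]] _ <-.
rewrite /pushforward (_ : _ @^-1` _ = `]a - c, b - c]%classic).
  by rewrite !lebesgue_measure_itv/= !lte_fin ltrD2r; case: ifP => // _;
    rewrite -!EFinB; congr (_%:E); ring.
by apply/seteqP; split => x /=; rewrite !in_itv /= ltrBlDr lerBrDr.
Qed.

(** Measurability on the translated interval belongs to the conclusion because it is only given on
    the original one. *)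
Lemma ge0_integral_shift (a b c : R) (G : R -> \bar R) :
  measurable_fun (`[a, b] : set (measurableTypeR R)) G -> (forall t, (0 <= G t)%E) ->
  (forall t : R, G (t + c) = G t) ->
  measurable_fun (`[a - c, b - c] : set (measurableTypeR R)) G /\
  (\int[mu]_(t in `[(a - c)%R, (b - c)%R]) G t = \int[mu]_(t in `[a, b]) G t)%E.
Proof.
move=> mG G0 per.
pose sh := (fun t => t + c) : measurableTypeR R -> measurableTypeR R.
have mshift : measurable_fun setT sh.
  by apply: continuous_measurable_fun => t; apply: cvgD; [exact: cvg_id|exact: cvg_cst].
have preE : sh @^-1` `[a, b] = `[a - c, b - c]%classic.
  by apply/seteqP; split => x /=; rewrite !in_itv /= lerBlDr lerBrDr.
have GE : G = G \o sh by apply/funext => t /=; rewrite per.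
split.
  rewrite GE; apply: (@measurable_comp _ _ _ _ _ _ (`[a, b] : set (measurableTypeR R))) => //.
  - by move=> _ [x] /= + <-; rewrite !in_itv /= lerBlDr lerBrDr.
  - exact: measurable_funTS.
rewrite [in LHS]GE -preE -(@ge0_integral_pushforward _ _ _ _ R sh mshift mu `[a, b] G) //.
by apply: eq_measure_integral => A mA _; exact: lebesgue_measure_shift.
Qed.

(** The piece over [- pi, 0] is translated to [pi, 2 pi]. This reconciles the two parameter
    intervals used for the spectral factor and for the norms. *)
Lemma ge0_periodic_integral (G : R -> \bar R) :
  measurable_fun (D : set (measurableTypeR R)) G -> (forall t, (0 <= G t)%E) ->
  (forall t, G (t + 2 * pi) = G t) ->
  (\int[mu]_(t in `[0%R, (2 * pi)%R]) G t = \int[mu]_(t in D) G t)%E.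
Proof.
move=> mG G0 per; have p0 := @pi_gt0 R.
have mG1 : measurable_fun (`[- pi, 0] : set (measurableTypeR R)) G.
  by apply: (measurable_funS measurable_Tdom _ mG); apply: subset_itvl; rewrite bnd_simp ltW.
have mG2 : measurable_fun (`[0, pi] : set (measurableTypeR R)) G.
  by apply: (measurable_funS measurable_Tdom _ mG); apply: subset_itvr; rewrite bnd_simp oppr_le0 ltW.
have per' t : G (t + - (2 * pi)) = G t by rewrite -[in RHS](subrK (2 * pi) t) per.
have [mG3 e3] := ge0_integral_shift mG1 G0 per'.
have E1 : - pi - - (2 * pi) = pi :> R by ring.
have E2 : 0 - - (2 * pi) = 2 * pi :> R by ring.
rewrite E1 E2 in mG3 e3.
have sub1 : (`[0, pi[ : set R) `<=` (`[0, pi] : set R) by apply: subset_itvl; rewrite bnd_simp.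
have sub2 : (`]0, pi] : set R) `<=` (`[0, pi] : set R) by apply: subset_itvr; rewrite bnd_simp.
have -> : `[0, 2 * pi]%classic = `[0, pi[%classic `|` `[pi, 2 * pi]%classic :> set R.
  by apply: itv_bndbnd_setU; rewrite bnd_simp; lra.
have -> : D = `[- pi, 0]%classic `|` `]0, pi]%classic.
  by apply: itv_bndbnd_setU; rewrite bnd_simp; lra.
have mG4 : measurable_fun (`[0, pi[ : set (measurableTypeR R)) G.
  exact: measurable_funS mG2.
have mG5 : measurable_fun (`]0, pi] : set (measurableTypeR R)) G.
  exact: measurable_funS mG2.
rewrite !ge0_integral_setU //.
- rewrite e3 addeC; congr (_ + _)%E.
  by rewrite integral_itv_bndo_bndc // integral_itv_obnd_cbnd.
- exact/measurable_funU.
- by apply/disj_setPS => x [/=]; rewrite !in_itv /= => /andP[_ x0] /andP[x1 _]; rewrite ltNge x0 in x1.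
- exact/measurable_funU.
- by apply/disj_setPS => x [/=]; rewrite !in_itv /= => /andP[_ x0] /andP[x1 _]; rewrite ltNge x1 in x0.
Qed.

Lemma periodic_Rintegral (u : R -> R) :
  measurable_fun (D : set (measurableTypeR R)) u -> (forall t, u (t + 2 * pi) = u t) ->
  (\int[mu]_(t in `[0, 2 * pi]) u t = \int[mu]_(t in D) u t)%R.
Proof.
move=> mf per; rewrite /Rintegral integralE [in RHS]integralE; congr (fine (_ - _)).
  apply: ge0_periodic_integral => // [|t].
    by apply: measurable_funepos; exact/measurable_EFinP.
  by rewrite !funeposE per.
apply: ge0_periodic_integral => // [|t].
  by apply: measurable_funeneg; exact/measurable_EFinP.
by rewrite !funenegE per.
Qed.

Lemma expi_periodic (t : R) : expi (t + 2 * pi) = expi t.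
Proof. by rewrite mulr_natl /expi cosD2pi sinD2pi. Qed.

Lemma herglotz_log_integralE (f : R[i] -> R) (r t : R) : 0 <= r < 1 ->
  mu.-integrable D (EFin \o (fun s => ln (f (expi s)))) ->
  herglotz_log_integral f (r%:C * expi t) = herglotz (fun s => ln (f (expi s))) r t.
Proof.
move=> hr il; have [iR iI] := herglotz_integrable t hr il.
rewrite /herglotz /cintegral /herglotz_log_integral; congr (_ +i* _).
  have E s : complex.Re ((expi s + r%:C * expi t) / (expi s - r%:C * expi t)) * ln (f (expi s))
    = complex.Re (circle_kernel r (t - s) * (ln (f (expi s)))%:C).
    by rewrite herglotz_kernelE // [RHS]complexReM /= mulr0 subr0.
  rewrite periodic_Rintegral => [|| s]; last by rewrite !expi_periodic.
    by apply: eq_Rintegral => s _; exact: E.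
  rewrite (_ : (fun s => _) = (fun s => complex.Re (circle_kernel r (t - s) * (ln (f (expi s)))%:C))).
    by apply/measurable_EFinP; exact: (measurable_int mu iR).
  by apply/funext => s; exact: E.
have E s : complex.Im ((expi s + r%:C * expi t) / (expi s - r%:C * expi t)) * ln (f (expi s))
  = complex.Im (circle_kernel r (t - s) * (ln (f (expi s)))%:C).
  by rewrite herglotz_kernelE //; case: (circle_kernel _ _) => x y; rewrite /= mulr0 add0r.
rewrite periodic_Rintegral => [|| s]; last by rewrite !expi_periodic.
  by apply: eq_Rintegral => s _; exact: E.
  rewrite (_ : (fun s => _) = (fun s => complex.Im (circle_kernel r (t - s) * (ln (f (expi s)))%:C))).
    by apply/measurable_EFinP; exact: (measurable_int mu iI).
  by apply/funext => s; exact: E.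
Qed.

Lemma spectral_factorE (f : R[i] -> R) (r t : R) : 0 <= r < 1 ->
  mu.-integrable D (EFin \o (fun s => ln (f (expi s)))) ->
  spectral_factor f (r%:C * expi t) = cexp (log_outer (fun s => f (expi s)) r t).
Proof. by move=> hr il; rewrite /spectral_factor herglotz_log_integralE. Qed.

End PeriodicShift.

(** * Radial limits, Fatou's lemma and the essential supremum *)

Section BoundaryValues.
Set Implicit Arguments.
Unset Strict Implicit.
Context {R : realType}.
Notation mu := (@lebesgue_measure R).
Notation D := (@Tdom R).

(* The lower integral makes sense without measurability of the smaller function. *)
Lemma ge0_le_integral_nonmeasurable (u v : R -> \bar R) :
  (forall t, D t -> (0 <= u t)%E) -> (forall t, D t -> (u t <= v t)%E) ->
  (\int[mu]_(t in D) u t <= \int[mu]_(t in D) v t)%E.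
Proof.
move=> u0 uv; have v0 t : D t -> (0 <= v t)%E by move=> Dt; exact: le_trans (u0 t Dt) (uv t Dt).
rewrite integral_mkcond [leRHS]integral_mkcond.
rewrite !ge0_integralTE; [|exact: erestrict_ge0|exact: erestrict_ge0].
apply: le_ereal_sup => _ [h hu <-]; exists h => // t.
apply: le_trans (hu t) _; rewrite /patch; case: ifPn => // /set_mem; exact: uv.
Qed.

Definition radius (n : nat) : R := 1 - n.+1%:R^-1.

Lemma radiusP n : 0 <= radius n < 1.
Proof.
rewrite /radius subr_ge0 invf_le1 ?ltr0n // ler1n /= gtrBl invr_gt0 ltr0n //.
Qed.

Lemma radius_cvg : radius n @[n --> \oo] --> (1 : R).
Proof.
rewrite -[X in _ --> X]subr0; apply: cvgB; first exact: cvg_cst.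
exact: cvg_harmonic.
Qed.

(* A radial limit that does not exist is 0 by convention of [lim]. *)
Lemma radial_lim_sqr_le (u : R -> R) (e : R) : 0 < e ->
  \forall n \near \oo, (lim (u r @[r --> 1^'-])) ^+ 2 - e <= u (radius n) ^+ 2.
Proof.
move=> e0; have [cu|/dvgP ->] := pselect (cvg (u r @[r --> 1^'-])); last first.
  by apply: nearW => n; rewrite expr0n /= sub0r (le_trans _ (sqr_ge0 _)) // oppr_le0 ltW.
have /cvg_at_leftP /(_ radius) := cu => /(_ (conj (fun n => (andP (radiusP n)).2) radius_cvg)) cn.
have /cvgrPdist_le /(_ _ e0) : (u (radius n) ^+ 2 @[n --> \oo] --> (lim (u r @[r --> 1^'-])) ^+ 2).
  by apply: cvgM.
apply: filterS => n; rewrite ler_norml => /andP[_]; lra.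
Qed.

Lemma limn_einf_ge (x : (\bar R)^nat) (c : \bar R) :
  (\forall n \near \oo, (c <= x n)%E) -> (c <= limn_einf x)%E.
Proof.
move=> [N _ hN]; rewrite limn_einf_lim.
apply: lime_ge; first exact: is_cvg_einfs.
exists N => // n /= Nn; apply: le_ereal_inf_tmp => _ [k /= nk <-].
by apply: hN; exact: leq_trans nk.
Qed.

(** Each coordinate gets half of the tolerance. The two radial limits are handled separately, and
    either may fail to exist. *)
Lemma csqnorm_boundary_value_le (F : R[i] -> R[i]) (t : R) :
  ((csqnorm (boundary_value F t))%:E <=
    limn_einf (fun n => (csqnorm (F ((radius n)%:C * expi t)))%:E))%E.
Proof.
apply/lee_subgt0Pr => e e0; apply: limn_einf_ge.
have e2 : 0 < e / 2 by rewrite divr_gt0.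
have hR := radial_lim_sqr_le (fun r => complex.Re (F (r%:C * expi t))) e2.
have hI := radial_lim_sqr_le (fun r => complex.Im (F (r%:C * expi t))) e2.
near=> n; rewrite -EFinB lee_fin.
have h1 : (lim (complex.Re (F (r%:C * expi t)) @[r --> 1^'-])) ^+ 2 - e / 2 <=
  complex.Re (F ((radius n)%:C * expi t)) ^+ 2 by near: n.
have h2 : (lim (complex.Im (F (r%:C * expi t)) @[r --> 1^'-])) ^+ 2 - e / 2 <=
  complex.Im (F ((radius n)%:C * expi t)) ^+ 2 by near: n.
rewrite /csqnorm /boundary_value /=; lra.
Unshelve. all: by end_near. Qed.

Lemma csqnorm_ge0 (z : R[i]) : 0 <= csqnorm z.
Proof. by rewrite addr_ge0 ?sqr_ge0. Qed.

(** Fatou's lemma along [radius]. Measurability is asked only on the inner circles; the boundary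
    function is compared with the lower limit through lower integrals. *)
Lemma H2_sqnorm_le (F : R[i] -> R[i]) (C : \bar R) :
  (forall r, 0 <= r < 1 ->
    measurable_fun (D : set (measurableTypeR R)) (fun t => (csqnorm (F (r%:C * expi t)))%:E) /\
    (\int[mu]_(t in D) (csqnorm (F (r%:C * expi t)))%:E <= C)%E) ->
  (H2_sqnorm F <= C)%E.
Proof.
move=> h; apply: le_trans (ge0_le_integral_nonmeasurable _
  (fun t _ => csqnorm_boundary_value_le F t)) _.
  by move=> t _; rewrite lee_fin csqnorm_ge0.
apply: le_trans (fatou mu measurable_Tdom (fun n => (h _ (radiusP n)).1) _) _.
  by move=> n t _; rewrite lee_fin csqnorm_ge0.
rewrite limn_einf_lim; apply: lime_le; first exact: is_cvg_einfs.
apply: nearW => n; apply: le_trans (h _ (radiusP n)).2.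
by apply: ereal_inf_lbound; exists n => //=.
Qed.

(** The exceptional set N is null for the restricted measure exactly when its intersection with the
    interval is null. *)
Lemma ae_Tdom_of_mrestr (P : R -> Prop) :
  {ae (mrestr mu (measurable_itv `[- pi, pi])), forall t : R, P t} ->
  {ae mu, forall t : R, D t -> P t}.
Proof.
move=> [N [mN N0 sN]]; exists (N `&` D); split => //.
  by apply: measurableI => //; exact: measurable_Tdom.
by move=> t /= nt; split; [apply: sN => /= Pt; apply: nt|apply: contrapT => Dt; apply: nt].
Qed.

Lemma Linf_norm_ge (f : R[i] -> R) :
  {ae mu, forall t : R, D t -> ((`|f (expi t)|)%:E <= Linf_norm f)%E}.
Proof. by apply: ae_Tdom_of_mrestr; exact: ess_sup_ge. Qed.

End BoundaryValues.

Theorem theorem2 (R : realType) (f g : R[i] -> R) :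
  (forall t : R, 0 <= f (expi t)) ->
  (forall t : R, 0 <= g (expi t)) ->
  lebesgue_measure.-integrable (@Tdom R) (fun t => (f (expi t))%:E) ->
  lebesgue_measure.-integrable (@Tdom R) (fun t => (g (expi t))%:E) ->
  (* log f, log g in L_1(T) (in particular f, g > 0 a.e.) *)
  {ae lebesgue_measure, forall t : R, t \in (@Tdom R) -> 0 < f (expi t)} ->
  {ae lebesgue_measure, forall t : R, t \in (@Tdom R) -> 0 < g (expi t)} ->
  lebesgue_measure.-integrable (@Tdom R) (fun t => (ln (f (expi t)))%:E) ->
  lebesgue_measure.-integrable (@Tdom R) (fun t => (ln (g (expi t)))%:E) ->
  (H2_sqnorm (fun z => (spectral_factor f z - spectral_factor g z)%R)
   <= 2%:E * L1_norm (fun w => (f w - g w)%R)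
      + (5 / 2)%:E * Linf_norm f * L1_norm (fun w => (ln (f w) - ln (g w))%R))%E.
Proof.
move=> f0 g0 if_ ig fpos gpos ilf ilg.
pose mu := @lebesgue_measure R; pose D := @Tdom R.
have {}fpos : {ae mu, forall s : R, D s -> 0 < f (expi s)}.
  by apply: (ae_imp fpos) => s h Ds; apply: h; exact: mem_set.
have {}gpos : {ae mu, forall s : R, D s -> 0 < g (expi s)}.
  by apply: (ae_imp gpos) => s h Ds; apply: h; exact: mem_set.
set F := fun z => _.
have L1E (u : R[i] -> R) : mu.-integrable D (EFin \o (fun t => u (expi t))) ->
    L1_norm u = ((\int[mu]_(t in D) `|u (expi t)|)%R)%:E.
  move=> iu; rewrite /L1_norm /Rintegral fineK //.
  exact: (integrable_fin_num measurable_Tdom (Tdom_integrable_norm iu)).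
have idf := Tdom_integrableB if_ ig; have idl := Tdom_integrableB ilf ilg.
rewrite (L1E (fun w => f w - g w) idf) (L1E (fun w => ln (f w) - ln (g w)) idl).
set I1 := Rintegral _ _ _; set I2 := Rintegral _ _ _.
have I10 : 0 <= I1 by exact: Rintegral_ge0.
have I20 : 0 <= I2 by exact: Rintegral_ge0.
have FE r t : 0 <= r < 1 -> F (r%:C * expi t) =
    cexp (log_outer (fun s => f (expi s)) r t) - cexp (log_outer (fun s => g (expi s)) r t).
  by move=> hr; rewrite /F !spectral_factorE.
have icsq r : 0 <= r < 1 ->
    mu.-integrable D (EFin \o (fun t => csqnorm (F (r%:C * expi t)))).
  move=> hr; rewrite (_ : (fun t => _) = fun t => csqnorm
    (cexp (log_outer (fun s => f (expi s)) r t) - cexp (log_outer (fun s => g (expi s)) r t))).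
    exact: csqnorm_log_outer_integrable.
  by apply/funext => t; rewrite FE.
have bound (C : \bar R) : (forall r, 0 <= r < 1 ->
    (((\int[mu]_(t in D) csqnorm (F (r%:C * expi t)))%R)%:E <= C)%E) -> (H2_sqnorm F <= C)%E.
  move=> h; apply: H2_sqnorm_le => r hr; split; first exact: measurable_int (icsq _ hr).
  apply: le_trans (h _ hr); rewrite /Rintegral fineK //.
  exact: (integrable_fin_num measurable_Tdom (icsq _ hr)).
have f_le : {ae mu, forall s : R, D s -> ((f (expi s))%:E <= Linf_norm f)%E}.
  by apply: (ae_imp (Linf_norm_ge f)) => t; rewrite ger0_norm.
(* The essential supremum is an extended real, so the infinite values need their own arguments. *)
case: (Linf_norm f) f_le => [M f_le| f_le| f_le].
- have M0 : 0 < M.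
    rewrite ltNge; apply/negP => M0.
    (* If M <= 0, then 0 < f <= M is absurd almost everywhere on the interval; integrating 1 = 0
       there turns this into 2 pi = 0. *)
    have z : {ae mu, forall s : R, D s -> (1 : R) = 0}.
      apply: (ae_imp2 fpos f_le) => s h1 h2 Ds; have := h1 Ds; have := h2 Ds.
      by rewrite lee_fin => a b; have := lt_le_trans b (le_trans a M0); rewrite ltxx.
    have := ae_eq_Tdom_integral (Tdom_integrable_cst 1) (Tdom_integrable_cst 0) z.
    by rewrite !Tdom_integral_cst mulr0 mulr1 => /eqP; rewrite mulf_eq0 pnatr_eq0 /= gt_eqF ?pi_gt0.
  have fM : {ae mu, forall s : R, D s -> 0 < f (expi s) <= M}.
    apply: (ae_imp2 fpos f_le) => s h1 h2 Ds; rewrite h1 //=.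
    by have := h2 Ds; rewrite lee_fin.
  have im : mu.-integrable D (EFin \o (fun s => Num.max (g (expi s) - M) 0)).
    have ic := Tdom_integrableB ig (Tdom_integrable_cst M).
    rewrite (_ : (fun s => _) = fun s => 1 / 2 * (`|g (expi s) - M| + (g (expi s) - M))).
      exact/Tdom_integrableZ/Tdom_integrableD/ic/Tdom_integrable_norm.
    apply/funext => s; case: (leP (g (expi s) - M) 0) => h.
      by rewrite ler0_norm //; lra.
    by rewrite gtr0_norm //; lra.
  apply: bound => r hr; rewrite -!EFinM -EFinD lee_fin.
  rewrite (_ : (\int[mu]_(t in D) csqnorm (F (r%:C * expi t)))%R = (\int[mu]_(t in D) csqnorm
    (cexp (log_outer (fun s => f (expi s)) r t) - cexp (log_outer (fun s => g (expi s)) r t)))%R).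
    exact: (@spectral_circle_bound R (fun s => f (expi s)) (fun s => g (expi s))).
  by apply: eq_Rintegral => t _; rewrite FE.
(* For an infinite supremum the right side is infinite unless [I2] = 0. Then the product is 0 by
   convention, but log f = log g almost everywhere and the spectral factors coincide. *)
- have [I2z|I2nz] := eqVneq I2 0; last first.
    rewrite gt0_muley ?lte_fin ?divr_gt0 // gt0_mulye ?lte_fin ?lt_def ?I2nz //.
    by rewrite addey ?leey // -EFinM.
  rewrite I2z mule0 adde0 -EFinM.
  have logE r t : 0 <= r < 1 ->
      log_outer (fun s => f (expi s)) r t = log_outer (fun s => g (expi s)) r t.
    move=> hr; apply/eqP; rewrite -subr_eq0 /log_outer -mulrBr -(herglotzB t hr ilf ilg).
    by rewrite (herglotz_eq0 t hr idl I2z) mulr0.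
  apply: bound => r hr.
  rewrite (_ : (\int[mu]_(t in D) csqnorm (F (r%:C * expi t)))%R = 0).
    by rewrite lee_fin mulr_ge0.
  have E t : csqnorm (F (r%:C * expi t)) = 0.
    by rewrite FE // logE // subrr /csqnorm /= expr0n addr0.
  by under eq_Rintegral do rewrite E; rewrite Tdom_integral_cst mulr0.
(* The value minus infinity would make the interval a null set. *)
- exfalso.
  have z : {ae mu, forall s : R, D s -> (1 : R) = 0} by apply: (ae_imp f_le) => s h /h.
  have := ae_eq_Tdom_integral (Tdom_integrable_cst 1) (Tdom_integrable_cst 0) z.
  by rewrite !Tdom_integral_cst mulr0 mulr1 => /eqP; rewrite mulf_eq0 pnatr_eq0 /= gt_eqF ?pi_gt0.
Qed.
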